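(* Let $G$ be a compact group, let $K$ be a homogeneous $G$-space and let $S\subset C(K)$ be a finite-dimensional $G$-invariant subspace. Then the following assertions are equivalent: (1) $S$ is $G$-accessible. (2) $S$ is a finite orthogonal sum of full isotypic components, that is, there exists a finite set $\Lambda\subset\widehat G$ such that $S=\bigoplus_{\pi\in\Lambda}\mathcal E_\pi(K)$.
   Context: All function spaces and representations are complex; inner products are linear in the first variable. A homogeneous $G$-space is a compact Hausdorff space $K$ with a continuous transitive left action $(g,x)\mapsto g\bullet x$ of the compact group $G$; $\mu_K$ is the unique $G$-invariant regular Borel probability measure on $K$. Put $(L_gf)(x)=f(g^{-1}\bullet x)$; $S\subset C(K)$ is $G$-invariant if $L_g(S)\subset S$ for all $g$. A (bounded linear) projection $Q\colon C(K)\to S$ is $G$-equivariant if $QL_g=L_gQ$ for all $g\in G$. A finite-dimensional $G$-invariant subspace $S\subset C(K)$ is $G$-accessible if every $G$-equivariant projection $Q\colon C(K)\to S$ coincides with the restriction to $C(K)$ of the orthogonal projection $L_2(K,\mu_K)\to S$. $\widehat G$ is the set of equivalence classes of irreducible unitary representations $\pi\colon G\to\mathcal U(V_\pi)$ (one representative chosen for each class). Fix $x_0\in K$ with stabilizer $H_{x_0}=\{h\in G:h\bullet x_0=x_0\}$ and put $V_\pi^{H_{x_0}}=\{u\in V_\pi:\pi(h)u=u\ \forall h\in H_{x_0}\}$ and $$\mathcal E_\pi(K)=\operatorname{span}\{\,g\bullet x_0\mapsto\langle v,\pi(g)u\rangle:\ u\in V_\pi^{H_{x_0}},\ v\in V_\pi\}\subset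 C(K),$$ the $\pi$-isotypic component of $L_2(K,\mu_K)$ (the sum of all irreducible subrepresentations equivalent to $V_\pi$); it is independent of $x_0$. *)

(* Defs.v *)
From HB Require Import structures.
From mathcomp Require Import all_boot all_order all_algebra.
From mathcomp Require Import complex.
From mathcomp Require Import all_classical all_reals all_analysis.

Set Implicit Arguments.
Unset Strict Implicit.
Unset Printing Implicit Defensive.

Import Order.TTheory GRing.Theory Num.Theory numFieldNormedType.Exports.

Local Open Scope classical_set_scope.
Local Open Scope ring_scope.
Local Open Scope complex_scope.

(* The topology and norm of the complex numbers R[i] are those that every
   numFieldType T carries on its regular module T^o. *)
HB.instance Definition _ (R : realType) := NormedModule.copy R[i] R[i]^o.

HB.mixin Record Group_isTopological G & Group G & Topological G := {
  mulg_continuous : continuous (fun p : G * G => (p.1 * p.2)%g) ;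
  invg_continuous : continuous (fun g : G => g^-1%g) }.

#[short(type="topGroupType")]
HB.structure Definition TopologicalGroup :=
  {G of Group_isTopological G & Group G & Topological G}.

Section LinearAlgebra.
Context {F : pzRingType} {E : lmodType F}.
Implicit Types (B W : set E).

Definition linear_span B : set E :=
  [set v | exists n (c : 'I_n -> F) (b : 'I_n -> E),
     (forall i, B (b i)) /\ v = \sum_(i < n) c i *: b i].

Definition subspace_set W :=
  W 0 /\ forall (a : F) v w, W v -> W w -> W (a *: v + w).

Definition finite_dim_subspace W :=
  exists n (b : 'I_n -> E), W = linear_span (range b).

End LinearAlgebra.

(* Complex Hilbert spaces; the inner product is linear in its first argument. *)
Record hilbertSpace (R : realType) := HilbertSpace {
  hilbert_sort :> completeNormedModType R[i] ;
  inner : hilbert_sort -> hilbert_sort -> R[i] ;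
  inner_linear : forall a u v w, inner (a *: u + v) w = a * inner u w + inner v w ;
  inner_conj : forall u v, inner u v = (inner v u)^* ;
  inner_norm : forall v, inner v v = `|v| ^+ 2 }.

Record unitary_rep (R : realType) (G : topGroupType) := UnitaryRep {
  rep_space : hilbertSpace R ;
  rep_fun :> G -> rep_space -> rep_space ;
  rep_linear : forall g (a : R[i]) v w,
    rep_fun g (a *: v + w) = a *: rep_fun g v + rep_fun g w ;
  rep_inner : forall g v w, inner (rep_fun g v) (rep_fun g w) = inner v w ;
  rep_1 : forall v, rep_fun 1%g v = v ;
  rep_M : forall g h v, rep_fun (g * h)%g v = rep_fun g (rep_fun h v) ;
  rep_continuous : forall v, continuous (fun g => rep_fun g v) }.

Section Representations.
Context {R : realType} {G : topGroupType}.
Implicit Types (pi sigma : unitary_rep R G).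

Definition irreducible pi :=
  (exists v : rep_space pi, v != 0) /\
  forall W : set (rep_space pi), closed W -> subspace_set W ->
    (forall g v, W v -> W (pi g v)) -> W = [set 0] \/ W = setT.

Definition unitarily_equivalent pi sigma :=
  exists U : rep_space pi -> rep_space sigma,
    [/\ forall (a : R[i]) v w, U (a *: v + w) = a *: U v + U w,
        forall v w, inner (U v) (U w) = inner v w,
        forall w, exists v, U v = w &
        forall g v, U (pi g v) = sigma g (U v)].

(* The family Ghat consists of one representative of each class of irreducible
   unitary representations of G; the index type I is then the set of classes. *)
Definition is_unitary_dual (I : Type) (Ghat : I -> unitary_rep R G) :=
  [/\ forall i, irreducible (Ghat i),
      forall i j, unitarily_equivalent (Ghat i) (Ghat j) -> i = j &
      forall sigma, irreducible sigma ->
        exists i, unitarily_equivalent sigma (Ghat i)].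

End Representations.

Definition borel (K : ptopologicalType) := g_sigma_algebraType (@open K).

Record homogeneous_space (G : topGroupType) (K : ptopologicalType)
    (act : G -> K -> K) : Prop := HomogeneousSpace {
  hs_compact : compact [set: K] ;
  hs_hausdorff : hausdorff_space K ;
  hs_act1 : forall x, act 1%g x = x ;
  hs_actM : forall g h x, act (g * h)%g x = act g (act h x) ;
  hs_continuous : continuous (fun p : G * K => act p.1 p.2) ;
  hs_transitive : forall x y, exists g, act g x = y }.

Section HomogeneousSpaces.
Context {R : realType} {G : topGroupType} {K : ptopologicalType}.
Variables (act : G -> K -> K) (mu : probability (borel K) R).
Implicit Types (f h : K -> R[i]) (S : set (K -> R[i])).

Definition invariant_measure :=
  forall g (A : set (borel K)), measurable A -> mu (act g @^-1` A) = mu A.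

Definition regular_measure :=
  forall A : set (borel K), measurable A ->
    mu A = ereal_inf [set mu U | U in [set U : set K | open U /\ A `<=` U]] /\
    mu A = ereal_sup [set mu C | C in [set C : set K | compact C /\ C `<=` A]].

Definition Cintegral f : R[i] :=
  Rintegral mu setT (fun x => complex.Re (f x)) +i*
  Rintegral mu setT (fun x => complex.Im (f x)).

Definition L2inner f h : R[i] := Cintegral (fun x => f x * (h x)^*).

Definition sup_norm f : R := sup [set complex.Re `|f x| | x in [set: K]].

Definition left_translate (g : G) f : K -> R[i] := fun x => f (act g^-1%g x).

Definition G_invariant S := forall g f, S f -> S (left_translate g f).

(* Q is only constrained on the set C(K) of continuous functions; its values at
   other functions are irrelevant. *)
Definition bounded_projection S (Q : (K -> R[i]) -> K -> R[i]) :=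
  [/\ forall f, continuous f -> S (Q f),
      forall (a : R[i]) f h, continuous f -> continuous h ->
        Q (a *: f + h) = a *: Q f + Q h,
      exists M : R, forall f, continuous f -> sup_norm (Q f) <= M * sup_norm f &
      forall f, S f -> Q f = f].

Definition equivariant (Q : (K -> R[i]) -> K -> R[i]) :=
  forall g f, continuous f -> Q (left_translate g f) = left_translate g (Q f).

(* p is the image of f under the orthogonal projection of L_2(K, mu) onto S. *)
Definition is_orthogonal_projection S f p :=
  S p /\ forall s, S s -> L2inner (f - p) s = 0.

Definition G_accessible S :=
  forall Q, bounded_projection S Q -> equivariant Q ->
    forall f, continuous f -> is_orthogonal_projection S f (Q f).

Definition stabilizer (x0 : K) : set G := [set h : G | act h x0 = x0].

Definition fixed_vectors (x0 : K) (pi : unitary_rep R G) : set (rep_space pi) :=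
  [set u | forall h : G, stabilizer x0 h -> pi h u = u].

(* The matrix coefficient g . x0 |-> <v, pi(g) u> is characterized by its values
   along the orbit map, which is onto. *)
Definition isotypic_component (x0 : K) (pi : unitary_rep R G) : set (K -> R[i]) :=
  linear_span [set f | exists u v, fixed_vectors x0 u /\
                  forall g, f (act g x0) = inner v (pi g u)].

(* Orthogonality of the components makes the sum, i.e. the span of their union,
   direct. *)
Definition is_orthogonal_sum_of_isotypic (x0 : K) (I : Type)
    (Ghat : I -> unitary_rep R G) (Lambda : set I) S :=
  (forall i j, Lambda i -> Lambda j -> i <> j ->
     forall f h, isotypic_component x0 (Ghat i) f ->
       isotypic_component x0 (Ghat j) h -> L2inner f h = 0) /\
  S = linear_span (\bigcup_(i in Lambda) isotypic_component x0 (Ghat i)).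

End HomogeneousSpaces.

(* Main.v *)
(** The theorem is reduced to the condition that S is stable under G-equivariant
    linear maps from subrepresentations of S into C(K); neither Haar measure on G
    nor the Peter-Weyl theorem is needed.

    (1) => (2).  Let U : V -> S be an equivariant embedding of an irreducible V,
    Phi : V -> C(K) equivariant and P the orthogonal projection onto S.  With
    Psi = Phi - P Phi, the map P + U Psi^* is an equivariant projection onto S,
    so Psi = 0 and Phi maps V into S.  For Phi the matrix coefficients of a
    vector fixed by the stabilizer this puts the isotypic component of V into S,
    and S is spanned by such components by complete reducibility.

    (2) => (1).  If S is a sum of isotypic components, every equivariant linear
    map B : S -> C(K) has values in S.  Given f, the pseudometric
    d(x, y) = sup_g |f(g x) - f(g y)| is continuous and G-invariant, and so is
    the kernel k(x, y) = max(0, e - d(x, y)).  For an equivariant projection Q,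
    B s (y) = <s, Q k(., y)> is equivariant in s, hence B s is in S; and <Q f, s>
    is a limit of multiples of <f, B s>, which vanish if f is orthogonal to S. *)

Require Import Defs.
From HB Require Import structures.
From mathcomp Require Import all_boot all_order all_algebra.
From mathcomp Require Import complex spectral.
From mathcomp Require Import all_classical all_reals all_analysis.
From mathcomp Require Import measurable_realfun.
From mathcomp Require Import ring lra.

Set Implicit Arguments.
Unset Strict Implicit.
Unset Printing Implicit Defensive.

Import Order.TTheory GRing.Theory Num.Theory numFieldNormedType.Exports.

Local Open Scope classical_set_scope.
Local Open Scope ring_scope.
Local Open Scope complex_scope.

(** * Linear algebra *)

(** A projection Q is bounded for the sup norm only, so f |-> <Q f, s> is a priori just a measure
    and Q comes with no adjoint in L_2. The kernel smooths this measure to the continuous function B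
    s. Its invariance is used twice: it makes B equivariant, and it makes the integral of k(x, .)
    the same constant for all x, so that smoothing f gives nearly a multiple of f. That B s stays in
    S rests on evaluation at x0: for an equivariant map from a finite-dimensional V to C(K) this
    functional is the pairing with a vector fixed by the stabilizer, so all values of the map are
    matrix coefficients of V. In (1) => (2), Psi takes values orthogonal to S; hence Psi^* vanishes
    on S and P + U Psi^* is still the identity there. Agreement with P means U Psi^* = 0, and U is
    injective. The members of the dual are arbitrary Hilbert spaces; their finite dimension is
    always deduced from an embedding into S. *)

Section LinearSpan.
Context {F : fieldType} {E : lmodType F}.
Implicit Types (B W X : set E).

Lemma subspace_setZ W a v : subspace_set W -> W v -> W (a *: v).
Proof. by case=> W0 WL Wv; rewrite -[_ *: _]addr0; exact: WL. Qed.

Lemma subspace_setD W v w : subspace_set W -> W v -> W w -> W (v + w).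
Proof. by case=> W0 WL Wv Ww; rewrite -[v]scale1r; exact: WL. Qed.

Lemma subspace_setB W v w : subspace_set W -> W v -> W w -> W (v - w).
Proof.
move=> Wsub Wv Ww; apply: subspace_setD => //; rewrite -scaleN1r.
exact: subspace_setZ.
Qed.

Lemma subspace_set_sum W (J : Type) (r : seq J) (P : pred J) (f : J -> E) :
  subspace_set W -> (forall j, P j -> W (f j)) -> W (\sum_(j <- r | P j) f j).
Proof.
move=> Wsub Wf; elim/big_ind : _ => //; first by case: Wsub.
by move=> ? ? ? ?; exact: subspace_setD.
Qed.

Lemma sub_linear_span B : B `<=` linear_span B.
Proof.
move=> v Bv; exists 1%N, (fun=> 1), (fun=> v); split=> //.
by rewrite big_ord1 scale1r.
Qed.

Lemma linear_span_min B W : subspace_set W -> B `<=` W -> linear_span B `<=` W.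
Proof.
move=> Wsub BW _ [n [c [b [Bb ->]]]]; apply: subspace_set_sum => // i _.
by apply: subspace_setZ => //; exact/BW.
Qed.

Lemma linear_span_subspace B : subspace_set (linear_span B).
Proof.
split; first by exists 0%N, (fun=> 0), (fun=> 0); split=> [[]//|]; rewrite big_ord0.
move=> a _ _ [n [c [b [Bb ->]]]] [m [d [e [Be ->]]]].
exists (n + m)%N,
  (fun i => match fintype.split i with inl j => a * c j | inr j => d j end),
  (fun i => match fintype.split i with inl j => b j | inr j => e j end); split.
  by move=> i; case: (fintype.split i).
rewrite big_split_ord /= scaler_sumr; congr (_ + _); apply: eq_bigr => i _.
  by rewrite (unsplitK (inl i)) scalerA.
by rewrite (unsplitK (inr i)).
Qed.

Lemma finite_dim_is_subspace W : finite_dim_subspace W -> subspace_set W.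
Proof. by move=> [n [b ->]]; exact: linear_span_subspace. Qed.

Lemma linear_span_mono B X : B `<=` X -> linear_span B `<=` linear_span X.
Proof.
move=> BX; apply: linear_span_min; first exact: linear_span_subspace.
exact: subset_trans BX (@sub_linear_span X).
Qed.

(** The coefficients form a row vector, so that sets of coefficients can be handled as row spaces of
    matrices. *)
Definition lincomb n (b : 'I_n -> E) (a : 'rV[F]_n) : E := \sum_i a 0 i *: b i.

Lemma lincomb_linear n (b : 'I_n -> E) c a a' :
  lincomb b (c *: a + a') = c *: lincomb b a + lincomb b a'.
Proof.
rewrite /lincomb scaler_sumr -big_split; apply: eq_bigr => i _.
by rewrite !mxE scalerDl scalerA.
Qed.

Lemma lincomb_delta n (b : 'I_n -> E) i : lincomb b (delta_mx 0 i) = b i.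
Proof.
rewrite /lincomb (bigD1 i)//= !mxE !eqxx scale1r big1 ?addr0// => j /negbTE ji.
by rewrite mxE ji andbF scale0r.
Qed.

Lemma linear_span_rangeP n (b : 'I_n -> E) v :
  linear_span (range b) v <-> exists a, v = lincomb b a.
Proof.
split; last first.
  move=> [a ->]; exists n, (a 0), b; split=> // i; exact: imageT.
apply: (@linear_span_min _ [set v | exists a, v = lincomb b a]).
  split; first by exists 0; rewrite /lincomb big1// => i _; rewrite mxE scale0r.
  by move=> c _ _ [a ->] [a' ->]; exists (c *: a + a'); rewrite lincomb_linear.
by move=> _ [i _ <-]; exists (delta_mx 0 i); rewrite lincomb_delta.
Qed.

(** A matrix of maximal rank with row space inside [P] works: adjoining a further row from [P]
    cannot raise the rank, so that row already lies in the row space. *)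
Lemma row_subspaceP n (P : set 'rV[F]_n) : subspace_set P ->
  exists A : 'M[F]_n, forall a, P a <-> (a <= A)%MS.
Proof.
move=> [P0 PL].
pose good r := `[< exists A : 'M[F]_n,
  (forall a : 'rV_n, (a <= A)%MS -> P a) /\ \rank A = r >].
have good0 : exists r, good r.
  exists 0%N; apply/asboolP; exists 0; split; last exact: mxrank0.
  by move=> a; rewrite submx0 => /eqP ->.
have good_le r : good r -> (r <= n)%N.
  by move=> /asboolP[A [_ <-]]; exact: rank_leq_row.
case: (ex_maxnP good0 good_le) => r /asboolP[A [PA rA]] rmax.
exists A => a; split=> [Pa|]; last exact: PA.
have /rmax : good (\rank (A + a)%MS).
  apply/asboolP; exists (A + a)%MS; split=> // a' /sub_addsmxP[[u w] /= ->].
  rewrite addrC [w]mx11_scalar mul_scalar_mx; apply: PL => //.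
  by apply: PA; exact: submxMl.
rewrite -rA => rle; have /mxrank_leqif_sup /geq_leqif := addsmxSl A a.
by rewrite rle => /esym sub; exact: submx_trans (addsmxSr A a) sub.
Qed.

Lemma coord_subspace n (b : 'I_n -> E) X : subspace_set X ->
  subspace_set [set a | X (lincomb b a)].
Proof.
move=> [X0 XL]; split=> /=.
  by rewrite /lincomb big1// => i _; rewrite mxE scale0r.
by move=> c a a' Xa Xa'; rewrite lincomb_linear; exact: XL.
Qed.

Lemma finite_dim_sub W X : finite_dim_subspace W -> subspace_set X ->
  X `<=` W -> finite_dim_subspace X.
Proof.
move=> [n [b ->]] Xsub XW.
have [A XA] := row_subspaceP (coord_subspace b Xsub).
exists n, (fun i => lincomb b (row i A)); apply/seteqP; split=> v.
  move=> Xv; have /linear_span_rangeP[a va] := XW _ Xv; rewrite va in Xv *.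
  have /submxP[u ->] := (XA a).1 Xv; apply/linear_span_rangeP; exists u.
  rewrite /lincomb; under [RHS]eq_bigr do rewrite scaler_sumr.
  rewrite exchange_big; apply: eq_bigr => i _ /=.
  rewrite mxE scaler_suml; apply: eq_bigr => j _.
  by rewrite scalerA mxE.
apply: (linear_span_min Xsub) => // _ [i _ <-]; apply: (XA _).2; exact: row_sub.
Qed.

(** [X] is chosen with a coefficient space of minimal rank. The family [b] may be dependent; the
    rank then exceeds the dimension by the dimension of the space of relations, which is the same
    for all subspaces. *)
Lemma minimal_subspace (P : set E -> Prop) W : finite_dim_subspace W ->
  (forall X, P X -> subspace_set X) -> P W ->
  exists X, [/\ X `<=` W, P X & forall Y, P Y -> Y `<=` X -> Y = X].
Proof.
move=> [n [b Wb]] Psub PW.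
pose repr (A : 'M[F]_n) X := forall a, X (lincomb b a) <-> (a <= A)%MS.
pose good r := `[< exists X (A : 'M[F]_n),
  [/\ X `<=` W, P X, repr A X & \rank A = r] >].
have good0 : exists r, good r.
  have [A XA] := row_subspaceP (coord_subspace b (Psub _ PW)).
  by exists (\rank A); apply/asboolP; exists W, A; split.
case: (ex_minnP good0) => r /asboolP[X [A [XW PX XA rA]]] rmin.
exists X; split=> // Y PY YX; apply/seteqP; split=> // v Xv.
have [B YB] := row_subspaceP (coord_subspace b (Psub _ PY)).
have BA : (B <= A)%MS.
  apply/row_subP => i; apply: (XA _).1; apply: YX; apply: (YB _).2.
  exact: row_sub.
have /rmin : good (\rank B).
  by apply/asboolP; exists Y, B; split=> //; exact: subset_trans XW.
rewrite -rA => rle; have /mxrank_leqif_sup /geq_leqif := BA.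
rewrite rle => /esym AB.
have := XW _ Xv; rewrite Wb => /linear_span_rangeP[a va]; rewrite va in Xv *.
by apply: (YB a).2; apply: submx_trans AB; exact: (XA a).1.
Qed.

End LinearSpan.

Definition linear_map (F : pzRingType) (E E' : lmodType F) (T : E -> E') :=
  forall a u v, T (a *: u + v) = a *: T u + T v.

Lemma linear_map0 (F : pzRingType) (E E' : lmodType F) (T : E -> E') :
  linear_map T -> T 0 = 0.
Proof.
by move=> /(_ (-1) 0 0); rewrite scaler0 addr0 scaleN1r addNr.
Qed.

Lemma linear_mapZ (F : pzRingType) (E E' : lmodType F) (T : E -> E') a v :
  linear_map T -> T (a *: v) = a *: T v.
Proof. by move=> TL; rewrite -[a *: v]addr0 TL linear_map0// addr0. Qed.

Lemma linear_mapD (F : pzRingType) (E E' : lmodType F) (T : E -> E') u v :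
  linear_map T -> T (u + v) = T u + T v.
Proof. by move=> TL; rewrite -[u in LHS]scale1r TL scale1r. Qed.

Lemma linear_mapB (F : pzRingType) (E E' : lmodType F) (T : E -> E') u v :
  linear_map T -> T (u - v) = T u - T v.
Proof.
by move=> TL; rewrite -scaleN1r addrC TL scaleN1r addrC.
Qed.

Lemma linear_map_sum (F : pzRingType) (E E' : lmodType F) (T : E -> E')
    (J : Type) (r : seq J) (f : J -> E) : linear_map T ->
  T (\sum_(j <- r) f j) = \sum_(j <- r) T (f j).
Proof.
move=> TL; elim/big_ind2 : _ => //; first exact: linear_map0.
by move=> u u' v v' <- <-; rewrite linear_mapD.
Qed.

Lemma setT_subspace (F : pzRingType) (E : lmodType F) : subspace_set [set: E].
Proof. by []. Qed.

Lemma image_subspace (F : fieldType) (E E' : lmodType F) (T : E -> E')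
    (X : set E) : linear_map T -> subspace_set X -> subspace_set (T @` X).
Proof.
move=> TL [X0 XL]; split; first by exists 0 => //; exact: linear_map0.
move=> a _ _ [u Xu <-] [v Xv <-]; exists (a *: u + v); first exact: XL.
exact: TL.
Qed.

(** Yields the finite dimension of a representation that embeds into a finite-dimensional space of
    functions. *)
Lemma finite_dim_inj (F : fieldType) (E E' : lmodType F) (W : set E')
    (T : E -> E') : finite_dim_subspace W -> linear_map T -> injective T ->
  (forall v, W (T v)) -> finite_dim_subspace [set: E].
Proof.
move=> Wfin TL Tinj WT.
have [||n [b Tb]] := finite_dim_sub (X := range T) Wfin.
- by apply: image_subspace => //; split.
- by move=> _ [v _ <-].
have /choice[b' b'E] : forall i, exists v, T v = b i.
  move=> i; suff [v _ <-] : range T (b i) by exists v.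
  by rewrite Tb; apply: sub_linear_span; exact: imageT.
exists n, b'; apply/seteqP; split=> // v _.
have : linear_span (range b) (T v) by rewrite -Tb; exact: imageT.
move=> /linear_span_rangeP[a Tva]; apply/linear_span_rangeP; exists a.
apply: Tinj; rewrite Tva linear_map_sum//; apply: eq_bigr => i _.
by rewrite linear_mapZ// b'E.
Qed.

Lemma finite_dim_range (F : fieldType) (E E' : lmodType F) (T : E -> E') :
  linear_map T -> finite_dim_subspace [set: E] -> finite_dim_subspace (range T).
Proof.
move=> TL [n [b bT]]; exists n, (T \o b); apply/seteqP; split.
  move=> _ [v _ <-]; have : linear_span (range b) v by rewrite -bT.
  move=> /linear_span_rangeP[a ->]; apply/linear_span_rangeP; exists a.
  rewrite (linear_map_sum _ _ TL); apply: eq_bigr => i _.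
  exact: linear_mapZ.
apply: linear_span_min; first by apply: image_subspace => //; split.
by move=> _ [i _ <-]; exact: imageT.
Qed.

(** * Inner products on a subspace, orthonormal bases and the Riesz representation *)

Section InnerProduct.
Context {R : realType} {E : lmodType R[i]}.
Implicit Types (W X : set E) (ip : E -> E -> R[i]).

(** The axioms are relative to [W] because the integral pairing is only known to satisfy them on
    continuous functions. *)
Record inner_product_on W ip : Prop := InnerProductOn {
  ip_linear : forall a u v w, W u -> W v -> W w ->
    ip (a *: u + v) w = a * ip u w + ip v w ;
  ip_conj : forall u v, W u -> W v -> ip u v = (ip v u)^* ;
  ip_ge0 : forall v, W v -> 0 <= ip v v ;
  ip_eq0 : forall v, W v -> ip v v = 0 -> v = 0 }.

Lemma inner_product_on_sub W X ip : X `<=` W ->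
  inner_product_on W ip -> inner_product_on X ip.
Proof.
move=> XW [L C P Z]; split; [move=> a u v w ? ? ?|move=> u v ? ?|move=> v ?..].
- by apply: L; exact: XW.
- by apply: C; exact: XW.
- by apply: P; exact: XW.
- by apply: Z; exact: XW.
Qed.

Definition orthonormal ip n (e : 'I_n -> E) :=
  forall i j, ip (e i) (e j) = (i == j)%:R.

Section OneForm.
Variables (W : set E) (ip : E -> E -> R[i]).
Hypotheses (Wsub : subspace_set W) (ipW : inner_product_on W ip).

Let W0 : W 0 := Wsub.1.

Lemma ip0l w : W w -> ip 0 w = 0.
Proof.
move=> Ww; have := ip_linear ipW (-1) W0 W0 Ww.
by rewrite scaler0 addr0 mulN1r addNr.
Qed.

Lemma ipZl a u w : W u -> W w -> ip (a *: u) w = a * ip u w.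
Proof.
by move=> Wu Ww; rewrite -[a *: u]addr0 (ip_linear ipW)// ip0l// addr0.
Qed.

Lemma ipDl u v w : W u -> W v -> W w -> ip (u + v) w = ip u w + ip v w.
Proof.
by move=> Wu Wv Ww; rewrite -[u in LHS]scale1r (ip_linear ipW)// mul1r.
Qed.

Lemma ipBl u v w : W u -> W v -> W w -> ip (u - v) w = ip u w - ip v w.
Proof.
move=> Wu Wv Ww; rewrite -scaleN1r ipDl//; last exact: subspace_setZ.
by rewrite ipZl// mulN1r.
Qed.

Lemma ip_suml n (c : 'I_n -> R[i]) (f : 'I_n -> E) w :
  (forall j, W (f j)) -> W w ->
  ip (\sum_j c j *: f j) w = \sum_j c j * ip (f j) w.
Proof.
(* Additivity of [ip] needs membership in [W], so the induction over the sum carries it along. *)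
move=> Wf Ww; pose P u a := W u /\ ip u w = a.
suff [] : P (\sum_j c j *: f j) (\sum_j c j * ip (f j) w) by [].
elim/big_ind2 : _ => [|u a v b [Wu <-] [Wv <-]|j _]; split=> //.
- exact: ip0l.
- exact: subspace_setD.
- exact: ipDl.
- exact: subspace_setZ.
- exact: ipZl.
Qed.

Lemma ip0r w : W w -> ip w 0 = 0.
Proof. by move=> Ww; rewrite (ip_conj ipW)// ip0l// conjc0. Qed.

Lemma ipZr a u w : W u -> W w -> ip w (a *: u) = a^*%C * ip w u.
Proof.
move=> Wu Ww; rewrite (ip_conj ipW)//; last exact: subspace_setZ.
by rewrite ipZl// rmorphM/= -(ip_conj ipW).
Qed.

Lemma ipDr u v w : W u -> W v -> W w -> ip w (u + v) = ip w u + ip w v.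
Proof.
move=> Wu Wv Ww; rewrite (ip_conj ipW)//; last exact: subspace_setD.
by rewrite ipDl// rmorphD/= -!(ip_conj ipW).
Qed.

Lemma ipBr u v w : W u -> W v -> W w -> ip w (u - v) = ip w u - ip w v.
Proof.
move=> Wu Wv Ww; rewrite (ip_conj ipW)//; last exact: subspace_setB.
by rewrite ipBl// rmorphB/= -!(ip_conj ipW).
Qed.

Lemma ip_sumr n (c : 'I_n -> R[i]) (f : 'I_n -> E) w :
  (forall j, W (f j)) -> W w ->
  ip w (\sum_j c j *: f j) = \sum_j (c j)^*%C * ip w (f j).
Proof.
move=> Wf Ww; rewrite (ip_conj ipW)//; last first.
  by apply: subspace_set_sum => // j _; exact: subspace_setZ.
rewrite ip_suml// rmorph_sum/=; apply: eq_bigr => j _.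
by rewrite rmorphM/= -(ip_conj ipW).
Qed.

Lemma ip_inj u v : W u -> W v -> (forall w, W w -> ip u w = ip v w) -> u = v.
Proof.
move=> Wu Wv uv; apply/eqP; rewrite -subr_eq0; apply/eqP.
have Wuv := subspace_setB Wsub Wu Wv.
by apply: (ip_eq0 ipW) => //; rewrite ipBl// uv// subrr.
Qed.

Lemma lincomb_in n (b : 'I_n -> E) a : (forall i, W (b i)) -> W (lincomb b a).
Proof.
by move=> Wb; apply: subspace_set_sum => // i _; exact: subspace_setZ.
Qed.

Lemma orthonormal_coef n (e : 'I_n -> E) (c : 'I_n -> R[i]) j :
  (forall i, W (e i)) -> orthonormal ip e -> ip (\sum_i c i *: e i) (e j) = c j.
Proof.
move=> We oe; rewrite ip_suml// (bigD1 j)//= oe eqxx mulr1 big1 ?addr0//.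
by move=> i /negbTE ij; rewrite oe ij mulr0.
Qed.

(** The family may be dependent: a vanishing residual is dropped, hence the separate length [m]. *)
Lemma gram_schmidt n (b : 'I_n -> E) : (forall i, W (b i)) ->
  exists m (e : 'I_m -> E), [/\ forall i, W (e i), orthonormal ip e &
    linear_span (range b) `<=` linear_span (range e)].
Proof.
elim: n b => [|n IH] b Wb.
  exists 0%N, (fun=> 0); split; [by case|by case|].
  by apply: linear_span_mono => v [i _ _]; case: i.
(* The tail is orthonormalized first; the head is then reduced against it. *)
have [//|m [e [We oe be]]] := IH (fun i => b (lift ord0 i)).
pose v := b ord0; pose w := v - \sum_i ip v (e i) *: e i.
have Ws : W (\sum_i ip v (e i) *: e i).
  by apply: subspace_set_sum => // i _; exact: subspace_setZ.
have Ww : W w by apply: subspace_setB => //; exact: Wb.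
have we i : ip w (e i) = 0.
  by rewrite ipBl ?orthonormal_coef ?subrr//; exact: Wb.
have ew i : ip (e i) w = 0 by rewrite (ip_conj ipW)// we conjc0.
have span_sub (X : set E) : subspace_set X -> (forall i, X (e i)) -> X w ->
    linear_span (range b) `<=` X.
  move=> Xsub Xe Xw; apply: linear_span_min => // _ [i _ <-].
  have [j ->|->] := unliftP ord0 i.
    have : linear_span (range e) `<=` X.
      by apply: linear_span_min => // _ [k _ <-].
    by apply; apply: be; apply: sub_linear_span; exact: imageT.
  rewrite -/v -[v](subrK (\sum_i ip v (e i) *: e i)); apply: subspace_setD => //.
  by apply: subspace_set_sum => // k _; exact: subspace_setZ.
have [w0|w0] := eqVneq w 0.
  exists m, e; split=> //; have Lsub := linear_span_subspace (range e).
  apply: span_sub => //; last by rewrite w0; exact: Lsub.1.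
  by move=> i; apply: sub_linear_span; exact: imageT.
have ww : ip w w != 0 by apply: contra_neq w0 => /(ip_eq0 ipW); exact.
have ww0 : 0 < ip w w by rewrite lt_neqAle eq_sym ww; exact: ip_ge0 ipW _ _.
pose c : R[i] := sqrtC (ip w w); have c0 : 0 < c by rewrite sqrtC_gt0.
pose ci : R[i] := c^-1.
(* [c] is positive, hence real, so its inverse is its own conjugate. *)
have cJ : ci^* = ci by rewrite /ci conjc_inv -(RRe_real (gtr0_real c0)) conjc_real.
pose e' i := if unlift ord0 i is Some j then e j else ci *: w.
exists m.+1, e'; split.
- by move=> i; rewrite /e'; case: unliftP => // _; exact: subspace_setZ.
- move=> i j; rewrite /e'; case: unliftP => [i' ->|->]; case: unliftP => [j' ->|->].
  + by rewrite oe (inj_eq lift_inj).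
  + by rewrite ipZr// ew mulr0 eq_sym (negbTE (neq_lift _ _)).
  + by rewrite ipZl// we mulr0 (negbTE (neq_lift _ _)).
  + rewrite ipZl// ?ipZr//; last exact: subspace_setZ.
    by rewrite cJ -[ip w w]sqrtCK -/c eqxx expr2 mulrA mulrACA mulVf ?mul1r// gt_eqF.
- have Lsub := linear_span_subspace (range e').
  have Le i : linear_span (range e') (e' i).
    by apply: sub_linear_span; exact: imageT.
  apply: span_sub => //.
    by move=> i; have := Le (lift ord0 i); rewrite /e' liftK.
  have := Le ord0; rewrite /e' unlift_none => Lw.
  by have := subspace_setZ c Lsub Lw; rewrite scalerA mulfV ?scale1r// gt_eqF.
Qed.

Hypothesis Wfin : finite_dim_subspace W.

Lemma orthonormal_basis : exists n (e : 'I_n -> E),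
  [/\ forall i, W (e i), orthonormal ip e &
      forall v, W v -> v = \sum_i ip v (e i) *: e i].
Proof.
move: Wfin => [n [b Wb]].
have [|m [e [We oe be]]] := @gram_schmidt _ b.
  by move=> i; rewrite Wb; apply: sub_linear_span; exact: imageT.
exists m, e; split=> // v; rewrite {1}Wb => /be /linear_span_rangeP[a ->].
by apply: eq_bigr => i _; rewrite orthonormal_coef.
Qed.

Lemma riesz_finite_dim (phi : E -> R[i]) :
  (forall a u v, W u -> W v -> phi (a *: u + v) = a * phi u + phi v) ->
  exists2 t, W t & forall v, W v -> phi v = ip v t.
Proof.
move=> phiL; have [n [e [We oe eE]]] := orthonormal_basis.
have phi0 : phi 0 = 0.
  by have := phiL (-1) 0 0 W0 W0; rewrite scaler0 addr0 mulN1r addNr.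
(* The conjugates compensate for conjugate-linearity in the second argument. *)
exists (\sum_i (phi (e i))^*%C *: e i).
  by apply: subspace_set_sum => // i _; exact: subspace_setZ.
move=> v Wv; rewrite {1}[v]eE// ip_sumr//.
pose P u a := W u /\ phi u = a.
suff [] : P (\sum_j ip v (e j) *: e j) (\sum_j (phi (e j))^*%C^*%C * ip v (e j)) by [].
elim/big_ind2 : _ => [|a u b w [Wu <-] [Ww <-]|j _]; split=> //.
- exact: subspace_setD.
- by have := phiL 1 u w Wu Ww; rewrite scale1r mul1r.
- exact: subspace_setZ.
- by rewrite conjcK mulrC -[_ *: _]addr0 phiL// phi0 addr0.
Qed.

End OneForm.
End InnerProduct.

(** * The modulus of complex numbers and continuous complex functions *)

Section Modulus.
Context {R : realType}.
Implicit Types z w : R[i].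

(** The norm of [R[i]] has values in [R[i]]; suprema and integrals need it in [R]. *)
Definition cabs z : R := complex.Re `|z|.

Lemma cabsE z : `|z| = (cabs z)%:C.
Proof. by rewrite /cabs RRe_real// normr_real. Qed.

Lemma cabs_ge0 z : 0 <= cabs z.
Proof. by rewrite -lecR -cabsE; exact: normr_ge0. Qed.

Lemma cabs0 : cabs 0 = 0.
Proof. by rewrite /cabs normr0. Qed.

Lemma cabs0_eq0 z : cabs z = 0 -> z = 0.
Proof. by move=> z0; apply/eqP; rewrite -normr_eq0 cabsE z0. Qed.

Lemma cabsD z w : cabs (z + w) <= cabs z + cabs w.
Proof. by rewrite -lecR rmorphD/= -!cabsE ler_normD. Qed.

Lemma cabsM z w : cabs (z * w) = cabs z * cabs w.
Proof. by apply: complexI; rewrite rmorphM/= -!cabsE normrM. Qed.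

Lemma cabsN z : cabs (- z) = cabs z.
Proof. by rewrite /cabs normrN. Qed.

Lemma cabsB z w : cabs (z - w) = cabs (w - z).
Proof. by rewrite -cabsN opprB. Qed.

Lemma cabs_real (x : R) : cabs x%:C = `|x|.
Proof.
by rewrite /cabs normc_def /= expr0n addr0 sqrtr_sqr.
Qed.

Lemma cabsJ z : cabs z^* = cabs z.
Proof. by rewrite /cabs normcJ. Qed.

Lemma cabs_ge_Re z : `|complex.Re z| <= cabs z.
Proof. by rewrite -lecR -cabsE normc_ge_Re. Qed.

Lemma cabs_i : cabs ('i%C : R[i]) = 1.
Proof. by rewrite /cabs normc_def /= expr0n expr1n add0r sqrtr1. Qed.

Lemma cabs_ge_Im z : `|complex.Im z| <= cabs z.
Proof.
have := cabs_ge_Re (z * 'i%C).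
by rewrite ReiNIm normrN cabsM cabs_i mulr1.
Qed.

Lemma cabs_sum (J : Type) (r : seq J) (F : J -> R[i]) :
  cabs (\sum_(j <- r) F j) <= \sum_(j <- r) cabs (F j).
Proof.
elim/big_ind2 : _ => //; first by rewrite cabs0.
by move=> z x w y zx wy; apply: le_trans (cabsD _ _) _; exact: lerD.
Qed.

(* Multiplying by a unimodular constant reduces a bound on the modulus to a
   bound on the real part. *)
Lemma cabs_rotate z : exists2 u, cabs u = 1 & u * z = (cabs z)%:C.
Proof.
have [->|z0] := eqVneq z 0.
  by exists 1; rewrite ?cabs0 ?mulr0//; rewrite /cabs normr1.
have n0 : `|z| != 0 by rewrite normr_eq0.
exists (`|z| / z); last by rewrite divfK// cabsE.
by apply: complexI; rewrite -cabsE normf_div normr_id divff.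
Qed.

End Modulus.

Section ContinuousFunctions.
Context {R : realType} {X : topologicalType}.
Implicit Types f h : X -> R[i].

Lemma continuous_cabsP f : continuous f <->
  forall x (e : R), 0 < e -> \forall y \near x, cabs (f x - f y) < e.
Proof.
split=> [cf x e e0|cf x].
  have /cvgrPdist_lt /(_ e%:C) := cf x; rewrite ltcR => /(_ e0).
  by apply: filterS => y; rewrite cabsE ltcR.
(* A positive element of [R[i]] is real, so only real radii occur. *)
apply/cvgrPdist_lt => -[a b]; rewrite ltcE/= => /andP[/eqP -> a0].
by near=> y; rewrite cabsE ltcR; near: y; exact: cf.
Unshelve. all: by end_near. Qed.

Lemma continuous_near_cabs f x (e : R) : continuous f -> 0 < e ->
  \forall y \near x, cabs (f x - f y) < e.
Proof. by move=> /continuous_cabsP; exact. Qed.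

Lemma continuous_constC (c : R[i]) : continuous (fun _ : X => c).
Proof. by move=> x; exact: cvg_cst. Qed.

Lemma continuousDC f h : continuous f -> continuous h -> continuous (f + h).
Proof. by move=> cf ch x; apply: cvgD; [exact: cf|exact: ch]. Qed.

Lemma continuousNC f : continuous f -> continuous (- f).
Proof. by move=> cf x; apply: cvgN; exact: cf. Qed.

Lemma continuousMC f h : continuous f -> continuous h -> continuous (f * h).
Proof. by move=> cf ch x; apply: cvgM; [exact: cf|exact: ch]. Qed.

Lemma continuousZC a f : continuous f -> continuous (a *: f).
Proof.
by move=> cf; exact: (continuousMC (@continuous_constC a) cf).
Qed.

Lemma continuousJC f : continuous f -> continuous (fun x => (f x)^*).
Proof.
move=> /continuous_cabsP cf; apply/continuous_cabsP => x e e0.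
near=> y; rewrite -rmorphB/= cabsJ; near: y; exact: cf.
Unshelve. all: by end_near. Qed.

Lemma continuous_subspace : subspace_set [set f : X -> R[i] | continuous f].
Proof.
split=> [|a f h cf ch]; first exact: continuous_constC.
exact: (continuousDC (@continuousZC a f cf) ch).
Qed.

Lemma continuous_sumC (J : Type) (r : seq J) (F : J -> X -> R[i]) :
  (forall j, continuous (F j)) -> continuous (\sum_(j <- r) F j).
Proof.
move=> cF; exact: (@subspace_set_sum _ _ [set f : X -> R[i] | continuous f] J r
  xpredT F continuous_subspace (fun j _ => cF j)).
Qed.

Lemma continuous_Re f : continuous f -> continuous (fun x => complex.Re (f x)).
Proof.
move=> /continuous_cabsP cf x; apply/cvgrPdist_lt => e e0.
near=> y; rewrite -raddfB/=; apply: le_lt_trans (cabs_ge_Re _) _.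
by near: y; exact: cf.
Unshelve. all: by end_near. Qed.

Lemma continuous_Im f : continuous f -> continuous (fun x => complex.Im (f x)).
Proof.
move=> /continuous_cabsP cf x; apply/cvgrPdist_lt => e e0.
near=> y; rewrite -raddfB/=; apply: le_lt_trans (cabs_ge_Im _) _.
by near: y; exact: cf.
Unshelve. all: by end_near. Qed.

Lemma continuous_realC (f : X -> R) :
  continuous f -> continuous (fun x => (f x)%:C).
Proof.
move=> cf; apply/continuous_cabsP => x e e0.
have /cvgrPdist_lt /(_ e e0) := cf x.
by apply: filterS => y; rewrite -rmorphB/= cabs_real.
Qed.

Lemma continuous_cabs f : continuous f -> continuous (fun x => cabs (f x)).
Proof.
move=> cf x; rewrite /cabs.
have : continuous (fun x => `|f x|) by move=> y; apply: cvg_norm; exact: cf.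
by move/continuous_Re; exact.
Qed.

Lemma continuous_bounded f : compact [set: X] -> continuous f ->
  exists2 M : R, 0 <= M & forall x, cabs (f x) <= M.
Proof.
move=> cX cf.
have : compact ((fun x => cabs (f x)) @` [set: X]).
  by apply: continuous_compact => //; apply/continuous_subspaceT/continuous_cabs.
move=> /compact_bounded[M [_ Mb]].
exists (`|M| + 1); first by rewrite addr_ge0.
move=> x; apply: le_trans (ler_norm _) _; apply: Mb => //.
by rewrite ltr_pwDr// ler_norm.
Qed.

End ContinuousFunctions.

(** * Integration of continuous functions on a homogeneous space *)

Section GroupActions.
Context {R : realType} {G : topGroupType} {K : ptopologicalType}.
Variable act : G -> K -> K.
Hypothesis homK : homogeneous_space act.
Implicit Types f h : K -> R[i].

Lemma act_continuous g : continuous (act g).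
Proof.
move=> x; have gx : (fun y => (g, y)) @ x --> (g, x).
  exact: (cvg_pair (cvg_cst g) cvg_id).
exact: (cvg_comp _ _ gx (@hs_continuous _ _ _ homK (g, x))).
Qed.

Lemma orbit_continuous x : continuous (fun g => act g x).
Proof.
move=> g; have gx : (fun g' => (g', x)) @ g --> (g, x).
  exact: (cvg_pair cvg_id (cvg_cst x)).
exact: (cvg_comp _ _ gx (@hs_continuous _ _ _ homK (g, x))).
Qed.

Lemma actK g : cancel (act g) (act g^-1%g).
Proof. by move=> x; rewrite -(hs_actM homK) mulVg (hs_act1 homK). Qed.

Lemma actKV g : cancel (act g^-1%g) (act g).
Proof. by move=> x; rewrite -(hs_actM homK) mulgV (hs_act1 homK). Qed.

Lemma left_translate_continuous g f :
  continuous f -> continuous (left_translate act g f).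
Proof.
by move=> cf x; apply: continuous_comp; [exact: act_continuous|exact: cf].
Qed.

Lemma left_translateM (g k : G) f :
  left_translate act (g * k)%g f = left_translate act g (left_translate act k f).
Proof.
by apply/funext => x; rewrite /left_translate invgM (hs_actM homK).
Qed.

Lemma left_translate1 f : left_translate act 1%g f = f.
Proof. by apply/funext => x; rewrite /left_translate invg1 (hs_act1 homK). Qed.

Lemma left_translateVK g f :
  left_translate act g (left_translate act g^-1%g f) = f.
Proof. by rewrite -left_translateM mulgV left_translate1. Qed.

End GroupActions.

Section RealIntegral.
Context {R : realType} {K : ptopologicalType}.
Variable mu : probability (borel K) R.
Hypothesis cK : compact [set: K].
Implicit Types f h : K -> R.

Lemma borel_measurable_continuous f :
  continuous f -> measurable_fun [set: borel K] (f : borel K -> R).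
Proof.
move=> /continuousP cf; apply: (measurability _ (RGenOpens.measurableE R)).
move=> _ [_ [a [b ->] <-]]; rewrite setTI; apply: sub_sigma_algebra.
exact/cf/interval_open.
Qed.

Lemma borel_integrable_continuous f :
  continuous f -> mu.-integrable [set: borel K] (EFin \o f).
Proof.
move=> cf; apply: measurable_bounded_integrable => //.
- by apply: fin_num_fun_lty; exact: fin_num_measure.
- exact: borel_measurable_continuous.
- have : compact (f @` [set: K]).
    by apply: continuous_compact => //; exact: continuous_subspaceT.
  move=> /compact_bounded[M [Mr Mb]]; exists M; split=> // N MN x _.
  by apply: Mb => //; exact: imageT.
Qed.

Lemma Rint_linear a f h : continuous f -> continuous h ->
  \int[mu]_x (a * f x + h x) = a * \int[mu]_x f x + \int[mu]_x h x.
Proof.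
move=> cf ch; have caf : continuous (fun x => a * f x).
  by move=> x; apply: cvgM; [exact: cvg_cst|exact: cf].
rewrite RintegralD//; try exact: borel_integrable_continuous.
by rewrite RintegralZl//; exact: borel_integrable_continuous.
Qed.

Lemma Rint_le f h : continuous f -> continuous h ->
  (forall x, f x <= h x) -> \int[mu]_x f x <= \int[mu]_x h x.
Proof.
by move=> cf ch fh; apply: le_Rintegral => //; exact: borel_integrable_continuous.
Qed.

Lemma Rint_cst (a : R) : \int[mu]_x a = a.
Proof.
transitivity (a * fine (mu [set: borel K])); first exact: Rintegral_cst.
by have -> := @probability_setT _ _ _ mu; rewrite mulr1.
Qed.

(** Change of variables: the pushforward of [mu] along [act g] is [mu]. *)
Lemma Rint_invariant (G : topGroupType) (act : G -> K -> K) g f :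
  homogeneous_space act -> invariant_measure act mu -> continuous f ->
  \int[mu]_x f (act g x) = \int[mu]_x f x.
Proof.
move=> homK inv cf; rewrite /Rintegral; congr fine.
have mact : measurable_fun [set: borel K] (act g : borel K -> borel K).
  apply: (@measurability _ _ (borel K) (borel K) setT (act g) (@open K)) => //.
  move=> _ [A oA <-].
  rewrite setTI; apply: sub_sigma_algebra.
  have /continuousP := @act_continuous _ _ _ homK g; exact.
have cfg : continuous (fun x => f (act g x)).
  by move=> x; apply: continuous_comp; [exact: act_continuous|exact: cf].
transitivity (\int[pushforward mu (act g : borel K -> borel K)]_x (f x)%:E)%E.
  rewrite integral_pushforward//.
  - by apply/measurable_EFinP; exact: borel_measurable_continuous.
  - exact: borel_integrable_continuous cfg.
by apply: eq_measure_integral => A mA _; exact: inv.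
Qed.

End RealIntegral.

Lemma compact_finite_cover (X : ptopologicalType) (J : choiceType)
    (U : J -> set X) : compact [set: X] -> (forall j, open (U j)) ->
  (forall x, exists j, U j x) ->
  exists r : seq J, forall x, exists2 j, j \in r & U j x.
Proof.
rewrite compact_cover => cX oU Ucov.
have [||D _ XD] := cX J setT U; first by move=> j _; exact: oU.
  by move=> x _; have [j Ujx] := Ucov x; exists j.
by exists (finmap.enum_fset D) => x; have [j Dj Ujx] := XD x I; exists j.
Qed.

Section ComplexIntegral.
Context {R : realType} {G : topGroupType} {K : ptopologicalType}.
Variables (act : G -> K -> K) (mu : probability (borel K) R).
Hypotheses (homK : homogeneous_space act) (inv : invariant_measure act mu).
Implicit Types f h : K -> R[i].

Let cK : compact [set: K] := hs_compact homK.

Lemma Cint_linear a f h : continuous f -> continuous h ->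
  Cintegral mu (a *: f + h) = a * Cintegral mu f + Cintegral mu h.
Proof.
move=> cf ch; have [cRf cIf] := (continuous_Re cf, continuous_Im cf).
have [cRh cIh] := (continuous_Re ch, continuous_Im ch).
have cN (u : K -> R) b : continuous u -> continuous (fun x => b * u x).
  by move=> cu x; apply: cvgM; [exact: cvg_cst|exact: cu].
have cL (u v : K -> R) b : continuous u -> continuous v ->
    continuous (fun x => b * u x + v x).
  by move=> cu cv x; apply: cvgD; [exact: cN|exact: cv].
case: a => a b; rewrite /Cintegral.
have -> : (fun x => complex.Re (((a +i* b) *: f + h) x)) =
    (fun x => a * complex.Re (f x) + (- b * complex.Im (f x) + complex.Re (h x))).
  apply/funext => x; rewrite -[_ x]/((a +i* b) * f x + h x).
  by case: (f x) => p q; case: (h x) => r s /=; rewrite mulNr addrA.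
have -> : (fun x => complex.Im (((a +i* b) *: f + h) x)) =
    (fun x => a * complex.Im (f x) + (b * complex.Re (f x) + complex.Im (h x))).
  apply/funext => x; rewrite -[_ x]/((a +i* b) * f x + h x).
  by case: (f x) => p q; case: (h x) => r s /=; rewrite addrA.
have cA := cL _ _ (- b) cIf cRh; have cB := cL _ _ b cRf cIh.
rewrite (Rint_linear mu cK a cRf cA) (Rint_linear mu cK a cIf cB).
rewrite (Rint_linear mu cK (- b) cIf cRh) (Rint_linear mu cK b cRf cIh).
by apply/eqP; rewrite eq_complex/= mulNr !addrA !eqxx.
Qed.

Lemma CintD f h : continuous f -> continuous h ->
  Cintegral mu (f + h) = Cintegral mu f + Cintegral mu h.
Proof.
by move=> cf ch; rewrite -[f in LHS]scale1r Cint_linear// mul1r.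
Qed.

Lemma Cint_cst c : Cintegral mu (fun=> c) = c.
Proof.
by case: c => a b; rewrite /Cintegral/= !Rint_cst.
Qed.

Lemma Cint0 : Cintegral mu 0 = 0.
Proof. exact: (Cint_cst 0). Qed.

Lemma CintZ a f : continuous f -> Cintegral mu (a *: f) = a * Cintegral mu f.
Proof.
move=> cf; have c0 := @continuous_constC R K 0.
by have := Cint_linear a cf c0; rewrite Cint_cst !addr0.
Qed.

Lemma CintB f h : continuous f -> continuous h ->
  Cintegral mu (f - h) = Cintegral mu f - Cintegral mu h.
Proof.
move=> cf ch; have := CintD cf (@continuousZC _ _ (-1) h ch).
by rewrite (CintZ (-1) ch) mulN1r => <-; rewrite scaleN1r.
Qed.

Lemma Cint_sum (J : Type) (r : seq J) (F : J -> K -> R[i]) :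
  (forall j, continuous (F j)) ->
  Cintegral mu (\sum_(j <- r) F j) = \sum_(j <- r) Cintegral mu (F j).
Proof.
move=> cF; pose P u a := continuous u /\ Cintegral mu u = a.
suff [] : P (\sum_(j <- r) F j) (\sum_(j <- r) Cintegral mu (F j)) by [].
elim/big_ind2 : _ => [|u a v b [cu <-] [cv <-]|j _].
- by split; [exact: (@continuous_constC R K 0)|exact: Cint0].
- by split; [exact: (continuousDC cu cv)|exact: (CintD cu cv)].
- by split.
Qed.

Lemma Cint_invariant g f : continuous f ->
  Cintegral mu (left_translate act g f) = Cintegral mu f.
Proof.
move=> cf; rewrite /Cintegral /left_translate.
rewrite (Rint_invariant cK g^-1%g homK inv (continuous_Re cf)).
by rewrite (Rint_invariant cK g^-1%g homK inv (continuous_Im cf)).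
Qed.

Lemma Cint_conj f : continuous f ->
  Cintegral mu (fun x => (f x)^*) = (Cintegral mu f)^*.
Proof.
move=> cf; rewrite /Cintegral/=.
have -> : (fun x => complex.Re (f x)^*) = (fun x => complex.Re (f x)).
  by apply/funext => x; case: (f x).
have -> : (fun x => complex.Im (f x)^*) = (fun x => -1 * complex.Im (f x) + 0).
  by apply/funext => x; case: (f x) => a b /=; rewrite mulN1r addr0.
have c0 : continuous (fun _ : K => 0 : R) by move=> x; exact: cvg_cst.
rewrite (Rint_linear mu cK (-1) (continuous_Im cf) c0) Rint_cst addr0 mulN1r.
by [].
Qed.

Lemma Cint_real (h : K -> R) :
  Cintegral mu (fun x => (h x)%:C) = (\int[mu]_x h x)%:C.
Proof. by rewrite /Cintegral/= Rint_cst. Qed.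

Lemma Cint_le f (h : K -> R) : continuous f -> continuous h ->
  (forall x, cabs (f x) <= h x) -> cabs (Cintegral mu f) <= \int[mu]_x h x.
Proof.
move=> cf ch fh; have [u u1 uI] := cabs_rotate (Cintegral mu f).
have -> : cabs (Cintegral mu f) = complex.Re (Cintegral mu (u *: f)).
  by rewrite CintZ// uI.
apply: Rint_le => //; first exact: (continuous_Re (@continuousZC _ _ u f cf)).
move=> x; apply: le_trans (ler_norm _) _; apply: le_trans (cabs_ge_Re _) _.
by rewrite -[_ x]/(u * f x) cabsM u1 mul1r.
Qed.

Lemma Cint_bound f (M : R) : continuous f -> (forall x, cabs (f x) <= M) ->
  cabs (Cintegral mu f) <= M.
Proof.
move=> cf fM; rewrite -[leRHS](Rint_cst mu); apply: Cint_le => //.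
by move=> x; exact: cvg_cst.
Qed.

(* Finitely many translates of the set where [h > h x / 2] cover [K], so the
   sum of the corresponding translates of [h] is bounded below. *)
Lemma Rint_gt0 (h : K -> R) x : continuous h -> (forall y, 0 <= h y) ->
  0 < h x -> 0 < \int[mu]_y h y.
Proof.
move=> ch h0 hx.
have chg g : continuous (fun y => h (act g y)).
  move=> y; apply: continuous_comp; last exact: ch.
  exact: (@act_continuous _ _ _ homK).
have [||r rcov] :=
  @compact_finite_cover _ _ (fun g => [set y | h x / 2 < h (act g y)]) cK.
- move=> g; have /continuousP := chg g; move=> /(_ [set r | h x / 2 < r]).
  by apply; exact: open_gt.
- move=> y; have [g gy] := hs_transitive homK y x.
  by exists g; rewrite /= gy ltr_pdivrMr// ltr_pMr// ltr1n.
pose H s y := \sum_(g <- s) h (act g y).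
have cH s : continuous (H s).
  elim: s => [|g s IH] y.
    have -> : H [::] = fun=> 0 by apply/funext => z; rewrite /H big_nil.
    exact: cvg_cst.
  have -> : H (g :: s) = fun z => h (act g z) + H s z.
    by apply/funext => z; rewrite /H big_cons.
  by apply: cvgD; [exact: chg|exact: IH].
have HI s : \int[mu]_y H s y = (\int[mu]_y h y) *+ size s.
  elim: s => [|g s IH].
    rewrite mulr0n -[RHS](Rint_cst mu); congr Rintegral.
    by apply/funext => y; rewrite /H big_nil.
  rewrite /= mulrS -IH -(Rint_invariant cK g homK inv ch) -[X in X + _]mul1r.
  rewrite -Rint_linear//; congr Rintegral.
  by apply/funext => y; rewrite /H big_cons mul1r.
have : h x / 2 <= (\int[mu]_y h y) *+ size r.
  rewrite -HI -[leLHS](Rint_cst mu); apply: Rint_le => //.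
    by move=> y; exact: cvg_cst.
  move=> y; have [g gr /ltW hg] := rcov y; apply: le_trans hg _.
  by rewrite /H (big_rem g)//= lerDl sumr_ge0.
move=> le2; have : 0 < (\int[mu]_y h y) *+ size r.
  by apply: lt_le_trans le2; rewrite divr_gt0.
by case: (size r) => [|n]; rewrite ?ltxx// pmulrn_lgt0.
Qed.

Lemma L2inner_continuous f h : continuous f -> continuous h ->
  continuous (fun x => f x * (h x)^*%C).
Proof. by move=> cf ch; exact: (continuousMC cf (continuousJC ch)). Qed.

Lemma L2innerE f h :
  L2inner mu f h = Cintegral mu (fun x => f x * (h x)^*%C).
Proof. by []. Qed.

(** Definiteness is where the action enters: by [Rint_gt0] an invariant measure charges every
    nonempty set on which a nonnegative continuous function is positive, so a continuous function of
    norm zero vanishes everywhere. *)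
Lemma L2inner_product :
  inner_product_on [set f : K -> R[i] | continuous f] (L2inner mu).
Proof.
have sqE f x : f x * (f x)^*%C = (cabs (f x) ^+ 2)%:C.
  by rewrite rmorphXn/= -cabsE sqr_normc.
split=> [a f h k cf ch ck|f h cf ch|f cf|f cf].
- rewrite !L2innerE.
  rewrite -(Cint_linear a (L2inner_continuous cf ck) (L2inner_continuous ch ck)).
  congr Cintegral; apply/funext => x.
  by rewrite -[(a *: f + h) x]/(a * f x + h x) mulrDl -mulrA.
- rewrite !L2innerE -(Cint_conj (L2inner_continuous ch cf)).
  by congr Cintegral; apply/funext => x; rewrite rmorphM/= conjcK mulrC.
- rewrite L2innerE; under eq_fun do rewrite sqE.
  by rewrite Cint_real ler0c; apply: Rintegral_ge0 => x _; exact: sqr_ge0.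
- rewrite L2innerE; under eq_fun do rewrite sqE.
  rewrite Cint_real => /complexI I0; apply/funext => x; apply: cabs0_eq0.
  apply/eqP; rewrite -sqrf_eq0; apply/negPn/negP => fx.
  suff : 0 < \int[mu]_y (cabs (f y) ^+ 2) by rewrite I0 ltxx.
  apply: (@Rint_gt0 _ x).
  + by move=> y; apply: cvgM; exact: (continuous_cabs cf).
  + by move=> y; exact: sqr_ge0.
  + by rewrite lt_neqAle eq_sym fx sqr_ge0.
Qed.

Lemma L2inner_bound f h (M N : R) : continuous f -> continuous h ->
  (forall x, cabs (f x) <= M) -> (forall x, cabs (h x) <= N) ->
  cabs (L2inner mu f h) <= M * N.
Proof.
move=> cf ch fM hN; rewrite L2innerE; apply: Cint_bound.
  exact: L2inner_continuous.
by move=> x; rewrite cabsM cabsJ; apply: ler_pM; rewrite ?cabs_ge0.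
Qed.

Lemma L2inner_translate g f h : continuous f -> continuous h ->
  L2inner mu (left_translate act g f) (left_translate act g h) = L2inner mu f h.
Proof.
by move=> cf ch; exact: (Cint_invariant g (L2inner_continuous cf ch)).
Qed.

Lemma L2inner_translateV g f h : continuous f -> continuous h ->
  L2inner mu (left_translate act g f) h =
  L2inner mu f (left_translate act g^-1%g h).
Proof.
move=> cf ch; rewrite -{1}[h](left_translateVK homK g).
have H := L2inner_translate g cf (@left_translate_continuous _ _ _ _ homK g^-1%g h ch).
exact: H.
Qed.

End ComplexIntegral.

(** * Unitary representations and matrix coefficients *)

Section HilbertSpaces.
Context {R : realType} (H : hilbertSpace R).

Lemma inner_inner_product : inner_product_on [set: H] (@inner R H).
Proof.
split=> [a u v w _ _ _|u v _ _|v _|v _].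
- exact: inner_linear.
- exact: inner_conj.
- by rewrite inner_norm exprn_ge0.
- by rewrite inner_norm => /eqP; rewrite expf_eq0/= normr_eq0 => /eqP.
Qed.

(** Polarization reduces the claim to the continuity of the norm. *)
Lemma inner_continuous (w : H) : continuous (fun v => inner v w).
Proof.
have sH := @setT_subspace _ H; have ipH := inner_inner_product.
have polarization v : inner v w = 4^-1 * ((`|v + w| ^+ 2 - `|v - w| ^+ 2) +
    'i%C * (`|v + 'i%C *: w| ^+ 2 - `|v - 'i%C *: w| ^+ 2)).
  have iJ : ('i%C : R[i])^*%C = - 'i%C by apply/eqP; rewrite eq_complex/= oppr0 !eqxx.
  have sqi : ('i%C : R[i]) * 'i%C = -1 by rewrite -expr2 sqr_i.
  rewrite -!inner_norm.
  rewrite !(ipBl sH ipH, ipBr sH ipH)// !(ipDl ipH, ipDr sH ipH)//.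
  rewrite !(ipZl sH ipH, ipZr sH ipH)// iJ.
  set a := inner v v; set b := inner v w; set c := inner w v; set d := inner w w.
  apply: (@mulfI _ (4 : R[i])); first by rewrite pnatr_eq0.
  rewrite mulrA divff ?pnatr_eq0// mul1r.
  rewrite [X in 'i%C * X](_ : _ = 'i%C * (2 * (c - b))); last by ring.
  by rewrite [X in _ = _ + X]mulrA sqi; ring.
have -> : (fun v => inner v w) = fun v => 4^-1 * ((`|v + w| ^+ 2 - `|v - w| ^+ 2) +
    'i%C * (`|v + 'i%C *: w| ^+ 2 - `|v - 'i%C *: w| ^+ 2)).
  by apply/funext.
have cN (c : H) : continuous (fun v : H => `|v + c| ^+ 2).
  move=> v; have nv : `|v' + c| @[v' --> v] --> `|v + c|.
    by apply: cvg_norm; apply: cvgD; [exact: cvg_id|exact: cvg_cst].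
  exact: (cvgM nv nv).
move=> v; apply: cvgM; first exact: cvg_cst.
apply: cvgD; first by apply: cvgB; exact: cN.
by apply: cvgM; [exact: cvg_cst|apply: cvgB; exact: cN].
Qed.

(** [irreducible] tests closed subspaces only; those to which it is applied below are all given by
    such orthogonality conditions. *)
Lemma closed_inner_eq0 (J : Type) (u : J -> H) :
  closed [set v | forall j, inner v (u j) = 0].
Proof.
have -> : [set v | forall j, inner v (u j) = 0] =
    \bigcap_j ((fun v => inner v (u j)) @^-1` [set 0]).
  by apply/seteqP; split=> v vu j; [move=> _|]; exact: vu.
apply: closed_bigI => j _.
have /continuous_closedP := @inner_continuous (u j); apply.
exact: (accessible_closed_set1 (hausdorff_accessible (@norm_hausdorff _ _))).

Qed.

End HilbertSpaces.

Section UnitaryRepresentations.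
Context {R : realType} {G : topGroupType}.
Implicit Types pi : unitary_rep R G.

Lemma repVK pi g v : pi g (pi g^-1%g v) = v.
Proof. by rewrite -rep_M mulgV rep_1. Qed.

Lemma rep_innerV pi g v w : inner (pi g v) w = inner v (pi g^-1%g w).
Proof. by rewrite -{1}[w](repVK g) rep_inner. Qed.

Lemma rep0 pi g : pi g 0 = 0.
Proof. exact: (linear_map0 (@rep_linear _ _ pi g)). Qed.

Context {K : ptopologicalType}.
Variable act : G -> K -> K.
Hypotheses (cG : compact [set: G]) (homK : homogeneous_space act).
Variable x0 : K.

Definition intertwines pi (Phi : rep_space pi -> K -> R[i]) :=
  linear_map Phi /\ forall g v, Phi (pi g v) = left_translate act g (Phi v).

(* By Riesz, evaluation at the base point is the pairing with a vector, which
   is fixed by the stabilizer. *)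
Lemma intertwines_isotypic pi (Phi : rep_space pi -> K -> R[i]) v :
  finite_dim_subspace [set: rep_space pi] -> intertwines Phi ->
  isotypic_component act x0 pi (Phi v).
Proof.
move=> Vfin [PhiL PhiE]; have ipH := inner_inner_product (rep_space pi).
have sH := @setT_subspace _ (rep_space pi).
have [|t _ tE] := riesz_finite_dim sH ipH Vfin (phi := fun v => Phi v x0).
  by move=> a u w _ _; rewrite PhiL.
apply: sub_linear_span; exists t, v; split=> [h hx0|g].
  (* For every w, <w, pi(h) t> = Phi (pi(h^-1) w) x0 = Phi w (h x0), and h fixes [x0]. *)
  apply: (ip_inj sH ipH) => // w _; rewrite (ip_conj ipH)// [RHS](ip_conj ipH)//.
  congr (_^*); rewrite -[h]invgK -rep_innerV -!tE// PhiE /left_translate invgK.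
  by rewrite hx0.
by rewrite -[g in RHS]invgK -rep_innerV -tE// PhiE /left_translate invgK.
Qed.

(* Independent of the chosen group element only if [u] is fixed by the
   stabilizer of [x0]. *)
Definition matrix_coef pi (u v : rep_space pi) : K -> R[i] :=
  fun x => inner v (pi (xget 1%g [set g | act g x0 = x]) u).

Lemma matrix_coef0 pi (v : rep_space pi) : matrix_coef 0 v = 0.
Proof.
apply/funext => x; rewrite /matrix_coef rep0.
have ipH := inner_inner_product (rep_space pi).
by rewrite (ip0r (@setT_subspace _ (rep_space pi)) ipH).
Qed.

Section MatrixCoef.
Variables (pi : unitary_rep R G) (u : rep_space pi).
Hypothesis fix_u : fixed_vectors act x0 u.

Lemma matrix_coefE v g : matrix_coef u v (act g x0) = inner v (pi g u).
Proof.
rewrite /matrix_coef; case: xgetP => [k _ /= kg|/(_ g) /(_ erefl)]; last by [].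
(* The chosen [k] and [g] move [x0] to the same point, so they differ by an element of the
   stabilizer. *)
have : pi (g^-1 * k)%g u = u.
  by apply: fix_u; rewrite /stabilizer/= (hs_actM homK) kg (actK homK).
by rewrite rep_M => {2}<-; rewrite repVK.
Qed.

Lemma eq_matrix_coef f v :
  (forall g, f (act g x0) = inner v (pi g u)) -> f = matrix_coef u v.
Proof.
move=> fE; apply/funext => x; have [g <-] := hs_transitive homK x0 x.
by rewrite fE matrix_coefE.
Qed.

Lemma matrix_coef_isotypic v : isotypic_component act x0 pi (matrix_coef u v).
Proof.
by apply: sub_linear_span; exists u, v; split=> // g; exact: matrix_coefE.
Qed.

Lemma matrix_coef_intertwines : intertwines (matrix_coef u).
Proof.
split=> [a v w|g v]; apply/funext => x.
  by rewrite -[RHS]/(a * matrix_coef u v x + matrix_coef u w x) -inner_linear.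
have [k <-] := hs_transitive homK x0 x.
rewrite matrix_coefE /left_translate -(hs_actM homK) matrix_coefE.
by rewrite rep_innerV -rep_M.
Qed.

(* The orbit map is closed, hence a quotient map. *)
Lemma matrix_coef_continuous v : continuous (matrix_coef u v).
Proof.
have cpi : continuous (fun g => inner v (pi g u)).
  move=> g; have -> : (fun g => inner v (pi g u)) = fun g => (inner (pi g u) v)^*%C.
    by apply/funext => k; exact: inner_conj.
  apply: (@continuousJC R G (fun g => inner (pi g u) v)) => k.
  exact: (cvg_comp _ _ (@rep_continuous _ _ pi u k) (@inner_continuous _ _ v _)).
apply/continuous_closedP => A cA.
have -> : matrix_coef u v @^-1` A =
    (fun g => act g x0) @` ((fun g => inner v (pi g u)) @^-1` A).
  apply/seteqP; split=> [x|_ [g gA <-]]; last by rewrite /= matrix_coefE.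
  by have [g <-] := hs_transitive homK x0 x; rewrite /= matrix_coefE; exists g.
apply: compact_closed; first exact: hs_hausdorff homK.
apply: continuous_compact.
  exact/continuous_subspaceT/(@orbit_continuous _ _ _ homK).
apply: (subclosed_compact _ cG) => //.
by have /continuous_closedP := cpi; exact.
Qed.

(** The vectors orthogonal to the orbit of [u] form a closed invariant subspace; it does not contain
    [u], so irreducibility makes it zero. *)
Lemma matrix_coef_inj : irreducible pi -> u != 0 -> injective (matrix_coef u).
Proof.
move=> [_ irr] u0 v w vw; have [cL _] := matrix_coef_intertwines.
pose W := [set v | forall g, inner v (pi g u) = 0].
have ipH := inner_inner_product (rep_space pi).
have sH := @setT_subspace _ (rep_space pi).
have Wvw : W (v - w).
  by move=> g; rewrite -matrix_coefE linear_mapB// vw subrr.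
have [||k z Wz g|W0|WT] := irr W.
- exact: closed_inner_eq0.
- split=> [g|a y z Wy Wz g]; first by rewrite (ip0l sH ipH).
  by rewrite inner_linear Wy Wz mulr0 addr0.
- by rewrite rep_innerV -rep_M.
- by move: Wvw; rewrite W0 => /eqP; rewrite subr_eq0 => /eqP.
- have : W u by rewrite WT.
  move=> /(_ 1%g); rewrite rep_1 => /(ip_eq0 ipH) uz.
  by rewrite uz ?eqxx// in u0.
Qed.

End MatrixCoef.

Lemma isotypic_continuous pi f :
  isotypic_component act x0 pi f -> continuous f.
Proof.
apply: (linear_span_min (W := [set f : K -> R[i] | continuous f])).
  exact: continuous_subspace.
by move=> h [u [v [fu /(eq_matrix_coef fu) ->]]]; exact: matrix_coef_continuous.
Qed.

End UnitaryRepresentations.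

(** * Invariant kernels *)

Section InvariantPseudometric.
Context {R : realType} {G : topGroupType} {K : ptopologicalType}.
Variable act : G -> K -> K.
Hypotheses (cG : compact [set: G]) (homK : homogeneous_space act).
Implicit Types f : K -> R[i].

Let act_near f g x (e : R) : continuous f -> 0 < e ->
  \forall g' \near g & y \near x, cabs (f (act g x) - f (act g' y)) < e.
Proof.
move=> cf e0.
have cF : continuous (fun p : G * K => f (act p.1 p.2)).
  by move=> p; exact: (cvg_comp _ _ (@hs_continuous _ _ _ homK p) (cf _)).
exact: (continuous_near_cabs (g, x) cF e0).
Qed.

(** Compactness of the group turns neighbourhoods of x that depend on g into a single one. *)
Lemma translates_equicontinuous f x (e : R) : continuous f -> 0 < e ->
  \forall y \near x, forall g, cabs (f (act g x) - f (act g y)) < e.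
Proof.
move=> cf e0; have /compact_near_coveringP cov := cG.
have e20 : 0 < e / 2 by rewrite divr_gt0.
pose P y g := cabs (f (act g x) - f (act g y)) < e.
suff /(cov K (nbhs x) P _) : forall g, [set: G] g ->
    \forall g' \near g & y \near x, P y g'.
  by apply: filterS => y Py g; exact: Py.
(* [act_near] compares with the pair (g, x) only; passing through f(g x), two halves of [e] compare
   f(g' x) with f(g' y). *)
move=> g _; have [[U V] [/= gU xV] UV] := act_near g x cf e20.
exists (U, V) => //= -[g' y] [/= Ug' Vy].
rewrite /P/= -(subrKA (f (act g x))) (splitr e).
apply: le_lt_trans (cabsD _ _) _; apply: ltrD; last exact: (UV (g', y)).
by rewrite cabsB; apply: (UV (g', x)); split=> //=; exact: nbhs_singleton.
Qed.

End InvariantPseudometric.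

Section InvariantKernel.
Context {R : realType} {G : topGroupType} {K : ptopologicalType}.
Variable act : G -> K -> K.
Hypotheses (cG : compact [set: G]) (homK : homogeneous_space act).
Variable f : K -> R[i].
Hypothesis cf : continuous f.

Let cK : compact [set: K] := hs_compact homK.

Definition orbit_dist (x y : K) : R :=
  sup [set cabs (f (act g x) - f (act g y)) | g in [set: G]].

Let has_sup_dist x y : has_sup [set cabs (f (act g x) - f (act g y)) | g in [set: G]].
Proof.
have [M _ fM] := continuous_bounded cK cf; split.
  by exists (cabs (f (act 1%g x) - f (act 1%g y))); exists 1%g.
exists (M + M) => _ [g _ <-]; apply: le_trans (cabsD _ _) _.
by rewrite cabsN lerD.
Qed.

Lemma orbit_dist_ge g x y : cabs (f (act g x) - f (act g y)) <= orbit_dist x y.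
Proof. by apply: (sup_upper_bound (has_sup_dist x y)); exists g. Qed.

Lemma orbit_dist_le x y e :
  (forall g, cabs (f (act g x) - f (act g y)) <= e) -> orbit_dist x y <= e.
Proof.
move=> fe; apply: ge_sup; first by case: (has_sup_dist x y).
by move=> _ [g _ <-].
Qed.

Lemma orbit_dist_ge1 x y : cabs (f x - f y) <= orbit_dist x y.
Proof. by have := orbit_dist_ge 1%g x y; rewrite !(hs_act1 homK). Qed.

Lemma orbit_dist_ge0 x y : 0 <= orbit_dist x y.
Proof. exact: le_trans (cabs_ge0 _) (orbit_dist_ge1 x y). Qed.

Lemma orbit_distxx x : orbit_dist x x = 0.
Proof.
apply/eqP; rewrite eq_le orbit_dist_ge0 andbT; apply: orbit_dist_le => g.
by rewrite subrr cabs0.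
Qed.

Lemma orbit_distC x y : orbit_dist x y = orbit_dist y x.
Proof.
by apply/eqP; rewrite eq_le; apply/andP; split; apply: orbit_dist_le => g;
  rewrite cabsB; exact: orbit_dist_ge.
Qed.

Lemma orbit_dist_triangle y x z :
  orbit_dist x z <= orbit_dist x y + orbit_dist y z.
Proof.
apply: orbit_dist_le => g; rewrite -(subrKA (f (act g y))).
by apply: le_trans (cabsD _ _) _; apply: lerD; exact: orbit_dist_ge.
Qed.

Lemma orbit_dist_act g x y : orbit_dist (act g x) (act g y) = orbit_dist x y.
Proof.
have le g' x' y' : orbit_dist (act g' x') (act g' y') <= orbit_dist x' y'.
  by apply: orbit_dist_le => k; rewrite -!(hs_actM homK); exact: orbit_dist_ge.
by apply/eqP; rewrite eq_le le/= -{1}[x](actK homK g) -{1}[y](actK homK g) le.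
Qed.

Lemma orbit_dist_near x (e : R) : 0 < e -> \forall y \near x, orbit_dist x y < e.
Proof.
move=> e0; have e20 : 0 < e / 2 by rewrite divr_gt0.
have := translates_equicontinuous cG homK x cf e20; apply: filterS => y fxy.
apply: (@le_lt_trans _ _ (e / 2)); last by rewrite ltr_pdivrMr// ltr_pMr// ltr1n.
by apply: orbit_dist_le => g; exact: ltW.
Qed.

Lemma lipschitz_continuousC (h : K -> R[i]) (C : R) : 0 <= C ->
  (forall x y, cabs (h x - h y) <= C * orbit_dist x y) -> continuous h.
Proof.
move=> C0 hC; apply/continuous_cabsP => x e e0.
(* Dividing by [C + 1] covers the case C = 0. *)
have C1 : 0 < C + 1 by rewrite ltr_wpDl.
have := orbit_dist_near x (divr_gt0 e0 C1); apply: filterS => y.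
rewrite ltr_pdivlMr// mulrC; apply: le_lt_trans; apply: le_trans (hC x y) _.
by rewrite ler_wpM2r ?orbit_dist_ge0// lerDl.
Qed.

Definition kern (e : R) x y : R := Num.max 0 (e - orbit_dist x y).

Lemma kern_ge0 e x y : 0 <= kern e x y.
Proof. by rewrite /kern le_max lexx. Qed.

Lemma kern_neq0 e x y : kern e x y != 0 -> orbit_dist x y < e.
Proof.
rewrite ltNge; apply: contra_neqN => ed.
by rewrite /kern max_l// subr_le0.
Qed.

Lemma kernxx e x : 0 < e -> kern e x x = e.
Proof. by move=> e0; rewrite /kern orbit_distxx subr0; apply/max_idPr/ltW. Qed.

Lemma kernC e x y : kern e x y = kern e y x.
Proof. by rewrite /kern orbit_distC. Qed.

Lemma kern_act e g x y : kern e (act g x) (act g y) = kern e x y.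
Proof. by rewrite /kern orbit_dist_act. Qed.

Lemma kern_lipschitz e x y z : `|kern e x y - kern e x z| <= orbit_dist y z.
Proof.
have le a b : kern e x a - kern e x b <= orbit_dist a b.
  rewrite lerBlDr /kern ge_max; apply/andP; split.
    by rewrite addr_ge0 ?orbit_dist_ge0// le_max lexx.
  have := orbit_dist_triangle a x b; have : e - orbit_dist x b <= kern e x b.
    by rewrite /kern le_max lexx orbT.
  by rewrite /kern; lra.
by rewrite ler_norml lerNl opprB le orbit_distC le.
Qed.

Definition kern_fun e y : K -> R[i] := fun x => (kern e x y)%:C.

Lemma kern_fun_lipschitz e x y z :
  cabs (kern_fun e y x - kern_fun e z x) <= orbit_dist y z.
Proof. by rewrite -rmorphB/= cabs_real kern_lipschitz. Qed.

Lemma kern_continuous e x : continuous (kern e x).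
Proof.
have : continuous (fun y => (kern e x y)%:C).
  apply: (lipschitz_continuousC (C := 1)) => // y z.
  by rewrite mul1r -rmorphB/= cabs_real kern_lipschitz.
by move=> /continuous_Re.
Qed.

Lemma kern_fun_continuous e y : continuous (kern_fun e y).
Proof.
have -> : kern_fun e y = fun x => (kern e y x)%:C.
  by apply/funext => x; rewrite /kern_fun kernC.
exact: (continuous_realC (@kern_continuous e y)).
Qed.

Lemma kern_fun_act e g y :
  kern_fun e (act g y) = left_translate act g (kern_fun e y).
Proof.
apply/funext => x; rewrite /left_translate /kern_fun.
by rewrite -{1}[x](actKV homK g) kern_act.
Qed.

(** The members are normalized kernels around finitely many points; the mesh [e] controls the error
    of the Riemann sums in [functional_eq0]. *)
Lemma partition_of_unity (e : R) : 0 < e -> exists (r : seq K) (p : K -> K -> R),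
  [/\ forall z, continuous (p z), forall z y, 0 <= p z y,
      forall z y, p z y != 0 -> orbit_dist z y < e &
      forall y, \sum_(z <- r) p z y = 1].
Proof.
move=> e0.
have [||r rcov] := @compact_finite_cover _ _ (fun z => [set y | 0 < kern e z y]) cK.
- move=> z; have /continuousP := @kern_continuous e z.
  by move=> /(_ [set a | 0 < a]); apply; exact: open_gt.
- by move=> y; exists y; rewrite /= kernxx.
pose W y := \sum_(z <- r) kern e z y.
have W0 y : 0 < W y.
  have [z zr kz] := rcov y; rewrite /W (big_rem z)//=.
  by rewrite ltr_pwDl// sumr_ge0// => *; exact: kern_ge0.
have cW : continuous W.
  rewrite /W; elim: r {rcov W W0} => [|z r IH] y.
    have -> : (fun y => \sum_(z <- [::]) kern e z y) = fun=> 0.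
      by apply/funext => x; rewrite big_nil.
    exact: cvg_cst.
  have -> : (fun y => \sum_(z <- z :: r) kern e z y) =
      fun y => kern e z y + \sum_(z <- r) kern e z y.
    by apply/funext => x; rewrite big_cons.
  by apply: cvgD; [exact: kern_continuous|exact: IH].
exists r, (fun z y => kern e z y / W y); split=> [z y|z y|z y|y].
- apply: cvgM; first exact: kern_continuous.
  apply: cvgV; last exact: cW.
  by rewrite gt_eqF//; exact: W0.
- by rewrite divr_ge0 ?kern_ge0// ltW.
- by rewrite mulf_eq0 negb_or => /andP[/kern_neq0].
- by rewrite -mulr_suml divff// gt_eqF//; exact: W0.
Qed.

Lemma convex_sum_bound (r : seq K) (p : K -> R) (u : K -> R[i]) (b : R) :
  (forall z, 0 <= p z) -> \sum_(z <- r) p z = 1 ->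
  (forall z, p z != 0 -> cabs (u z) <= b) ->
  cabs (\sum_(z <- r) (p z)%:C * u z) <= b.
Proof.
move=> p0 p1 ub; apply: le_trans (cabs_sum _ _) _.
rewrite -[leRHS]mul1r -p1 mulr_suml; apply: ler_sum => z _.
rewrite cabsM cabs_real ger0_norm//.
have [->|pz] := eqVneq (p z) 0; first by rewrite !mul0r.
by rewrite ler_wpM2l// ub.
Qed.

End InvariantKernel.

Section KernelFunctional.
Context {R : realType} {G : topGroupType} {K : ptopologicalType}.
Variables (act : G -> K -> K) (mu : probability (borel K) R).
Hypotheses (cG : compact [set: G]) (homK : homogeneous_space act).
Hypothesis inv : invariant_measure act mu.

Let cK : compact [set: K] := hs_compact homK.

(* The normalized kernel operator approximates [f] uniformly, and it is itself
   a uniform limit of finite combinations of the functions [kern_fun e z]; so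
   the value of a bounded functional at [f] is determined by its values on
   these functions. *)
Lemma functional_eq0 (f : K -> R[i]) (Lam : (K -> R[i]) -> R[i]) (C : R) :
  continuous f -> 0 <= C ->
  (forall a u v, continuous u -> continuous v ->
     Lam (a *: u + v) = a * Lam u + Lam v) ->
  (forall u (M : R), continuous u -> (forall x, cabs (u x) <= M) ->
     cabs (Lam u) <= C * M) ->
  (forall e, 0 < e ->
     Cintegral mu (fun y => f y * Lam (kern_fun act f e y)) = 0) ->
  Lam f = 0.
Proof.
move=> cf C0 LamL LamC LamI; apply: cabs0_eq0.
have ck e y : continuous (kern_fun act f e y) by exact: kern_fun_continuous.
(* Here [e] is the width of the kernel. *)
suff le0 e : 0 < e -> cabs (Lam f) <= C * e.
  apply/eqP; rewrite eq_le cabs_ge0 andbT; apply/ler_addgt0Pr => e e0.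
  rewrite add0r; have C1 : 0 < C + 1 by rewrite ltr_wpDl.
  apply: le_trans (le0 (e / (C + 1)) (divr_gt0 e0 C1)) _.
  by rewrite mulrA ler_pdivrMr// mulrC ler_wpM2l ?lerDl// ltW.
move=> e0.
have [F F0 fF] := continuous_bounded cK cf.
(* [c] is the mass of the kernel; by invariance and transitivity it is the same at every point. *)
pose x0 : K := point; pose c : R := \int[mu]_y kern act f e x0 y.
have ckern x : continuous (kern act f e x) by exact: kern_continuous.
have cE x : \int[mu]_y kern act f e x y = c.
  have [g <-] := hs_transitive homK x0 x.
  rewrite -(Rint_invariant cK g homK inv (ckern (act g x0))).
  by congr Rintegral; apply/funext => y; rewrite kern_act.
have c0 : 0 < c.
  apply: (@Rint_gt0 _ _ _ act mu homK inv _ x0) => // [y|].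
    exact: kern_ge0.
  by rewrite kernxx.
pose beta y := Lam (kern_fun act f e y).
have LamB u v : continuous u -> continuous v -> Lam (u - v) = Lam u - Lam v.
  move=> cu cv; have := LamL (-1) v u cv cu.
  by rewrite mulN1r scaleN1r [- v + u]addrC [- Lam v + _]addrC.
have beta_lip y z : cabs (beta y - beta z) <= C * orbit_dist act f y z.
  rewrite /beta -(LamB _ _ (ck e y) (ck e z)); apply: LamC.
    exact: (continuousDC (ck e y) (continuousNC (ck e z))).
  by move=> x; exact: kern_fun_lipschitz.
have cbeta : continuous beta by exact: (lipschitz_continuousC cG homK cf C0).
(* [d] is the mesh of a partition of unity, independent of [e]. The terms containing it vanish as
   [d] tends to 0, and division by [c] leaves C e. *)
suff key d : 0 < d ->
    c * cabs (Lam f) <= C * (e * c + F * d) + F * (C * d).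
  rewrite -(ler_pM2l c0) [leRHS]mulrC -mulrA.
  apply/ler_addgt0Pr => h h0.
  (* With this denominator the two terms in [d] add up to at most [h]. *)
  have D0 : 0 < 2 * (C * F) + 1 by rewrite ltr_wpDl// !mulr_ge0.
  apply: le_trans (key _ (divr_gt0 h0 D0)) _.
  rewrite mulrDr -addrA lerD2l.
  have -> : C * (F * (h / (2 * (C * F) + 1))) + F * (C * (h / (2 * (C * F) + 1)))
    = (2 * (C * F) * h) / (2 * (C * F) + 1) by ring.
  by rewrite ler_pdivrMr// mulrC ler_wpM2l ?lerDl// ltW.
move=> d0; have [r [p [cp p0 pd p1]]] := partition_of_unity cG homK cf d0.
pose pC z : K -> R[i] := fun y => (p z y)%:C.
have cpC z : continuous (pC z) := continuous_realC (@cp z).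
(* [Fd] is a Riemann sum, with weights [a z], for the integral of f(y) k(., y) over y. *)
pose a z := Cintegral mu (pC z * f).
pose Fd := \sum_(z <- r) a z *: kern_fun act f e z.
have cak z : continuous (a z *: kern_fun act f e z).
  exact: (@continuousZC _ _ (a z) _ (ck e z)).
have cFd : continuous Fd := continuous_sumC cak.
have LamFd : Lam Fd = \sum_(z <- r) a z * beta z.
  pose P u b := continuous u /\ Lam u = b.
  suff [] : P Fd (\sum_(z <- r) a z * beta z) by [].
  have c0' := @continuous_constC R K 0.
  have Lam0 : Lam 0 = 0 by rewrite -[X in Lam X](subrr 0) LamB ?subrr.
  rewrite /Fd; elim/big_ind2 : _ => [|b u b' v [cu <-] [cv <-]|z _].
  - by split; [exact: c0'|exact: Lam0].
  - split; first exact: (continuousDC cu cv).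
    by have := LamL 1 u v cu cv; rewrite scale1r mul1r.
  - split; first exact: (@continuousZC _ _ (a z) _ (ck e z)).
    by have := LamL (a z) _ 0 (ck e z) c0'; rewrite !addr0 Lam0 addr0.
have near_f x : cabs ((c%:C *: f - Fd) x) <= e * c + F * d.
  have FdE : Fd x = \sum_(z <- r) a z * (kern act f e x z)%:C.
    rewrite /Fd; elim: (r) => [|z s IH]; first by rewrite !big_nil.
    by rewrite !big_cons -IH.
  have ckx := continuous_realC (ckern x).
  (* Since the [p z] sum to 1, c f(x) - Fd(x) is the integral over y of the convex combination of
     the values k(x, y) f(x) - k(x, z) f(y). *)
  pose u z := f x *: (fun y => (kern act f e x y)%:C) - (kern act f e x z)%:C *: f.
  have cu z : continuous (u z).
    apply: (continuousDC (@continuousZC _ _ (f x) _ ckx)).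
    exact: (continuousNC (@continuousZC _ _ (kern act f e x z)%:C _ cf)).
  have cpu z : continuous (pC z * u z) := continuousMC (@cpC z) (cu z).
  have -> : (c%:C *: f - Fd) x = Cintegral mu (\sum_(z <- r) pC z * u z).
    rewrite -[LHS]/(c%:C * f x - Fd x) FdE.
    have -> : \sum_(z <- r) pC z * u z =
        f x *: (fun y => (kern act f e x y)%:C) -
        \sum_(z <- r) (kern act f e x z)%:C *: (pC z * f).
      apply/funext => y; rewrite fct_sumE.
      transitivity (\sum_(z <- r) (f x * (kern act f e x y)%:C * (p z y)%:C -
          (kern act f e x z)%:C * (pC z y * f y))).
        by apply: eq_bigr => z _; rewrite /pC/u -[LHS]/((p z y)%:C *
          (f x * (kern act f e x y)%:C - (kern act f e x z)%:C * f y)); ring.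
      rewrite sumrB -mulr_sumr -rmorph_sum/= p1 mulr1.
      rewrite -[RHS]/(f x * (kern act f e x y)%:C -
        (\sum_(z <- r) (kern act f e x z)%:C *: (pC z * f)) y).
      by rewrite fct_sumE.
    have cpf z : continuous (pC z * f) := continuousMC (@cpC z) cf.
    have ckpf z : continuous ((kern act f e x z)%:C *: (pC z * f)).
      exact: (@continuousZC _ _ _ _ (@cpf z)).
    have cS : continuous (\sum_(z <- r) (kern act f e x z)%:C *: (pC z * f)).
      exact: (continuous_sumC ckpf).
    rewrite (CintB mu homK (@continuousZC _ _ (f x) _ ckx) cS).
    rewrite (CintZ mu homK (f x) ckx) Cint_real cE mulrC; congr (_ - _).
    rewrite (Cint_sum mu homK _ ckpf); apply: eq_bigr => z _.
    by rewrite (CintZ mu homK _ (@cpf z)) mulrC.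
  have ch : continuous (fun y => e * kern act f e x y + F * d).
    move=> y; apply: cvgD; last exact: cvg_cst.
    by apply: cvgM; [exact: cvg_cst|exact: ckern].
  have -> : e * c + F * d = \int[mu]_y (e * kern act f e x y + F * d).
    have cFd' : continuous (fun _ : K => F * d) by move=> y; exact: cvg_cst.
    by rewrite (Rint_linear mu cK e (ckern x) cFd') Rint_cst cE.
  have csum := @continuous_sumC _ _ _ r _ cpu.
  apply: (Cint_le mu homK csum ch) => y; rewrite fct_sumE.
  apply: (convex_sum_bound (p := p ^~ y) (u := fun z => u z y)) => // z pz.
  (* The first term is small because the kernel vanishes at distance [e] or more, the second because
     [p z y] is nonzero only at distance below [d]. *)
  have -> : u z y = (kern act f e x y)%:C * (f x - f y) +
      (kern act f e x y - kern act f e x z)%:C * f y.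
    rewrite rmorphB/= /u -[LHS]/(f x * (kern act f e x y)%:C -
      (kern act f e x z)%:C * f y); ring.
  apply: le_trans (cabsD _ _) _; rewrite !cabsM !cabs_real; apply: lerD.
    rewrite ger0_norm ?kern_ge0// mulrC.
    have [->|k0] := eqVneq (kern act f e x y) 0; first by rewrite !mulr0.
    rewrite ler_wpM2r ?kern_ge0//; apply: le_trans (ltW (kern_neq0 k0)).
    exact: orbit_dist_ge1.
  rewrite mulrC; apply: ler_pM => //; first exact: cabs_ge0.
  apply: le_trans (kern_lipschitz homK cf e x y z) _.
  by rewrite (orbit_distC homK cf) ltW// pd.
have LamFd_le : cabs (Lam Fd) <= F * (C * d).
  (* The integral of f [beta] vanishes by [LamI] and may be subtracted; then [beta z - beta y] is at
     most C d in modulus wherever [p z y] is nonzero. *)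
  pose v z : K -> R[i] := f * ((fun=> beta z) - beta).
  have cv z : continuous (v z).
    have cz := @continuous_constC R K (beta z).
    exact: (continuousMC cf (continuousDC cz (continuousNC cbeta))).
  have cpv z : continuous (pC z * v z) := continuousMC (@cpC z) (cv z).
  have -> : Lam Fd = Cintegral mu (\sum_(z <- r) pC z * v z).
    have cpf z : continuous (pC z * f) := continuousMC (@cpC z) cf.
    have cbpf z : continuous (beta z *: (pC z * f)).
      exact: (@continuousZC _ _ _ _ (@cpf z)).
    have -> : \sum_(z <- r) pC z * v z =
        \sum_(z <- r) beta z *: (pC z * f) - f * beta.
      apply/funext => y; rewrite fct_sumE.
      transitivity (\sum_(z <- r) (beta z * (pC z y * f y) -
          f y * beta y * (p z y)%:C)).
        by apply: eq_bigr => z _; rewrite /pC/v -[LHS]/((p z y)%:C *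
          (f y * (beta z - beta y))); ring.
      rewrite sumrB -mulr_sumr -rmorph_sum/= p1 mulr1.
      rewrite -[RHS]/((\sum_(z <- r) beta z *: (pC z * f)) y - f y * beta y).
      by rewrite fct_sumE.
    rewrite (CintB mu homK (continuous_sumC cbpf) (continuousMC cf cbeta)).
    rewrite -[Cintegral mu (f * beta)]/(Cintegral mu (fun y => f y * beta y)).
    rewrite LamI// subr0 LamFd (Cint_sum mu homK _ cbpf); apply: eq_bigr => z _.
    by rewrite (CintZ mu homK _ (@cpf z)) mulrC.
  have csum := @continuous_sumC _ _ _ r _ cpv.
  apply: (Cint_bound mu homK csum) => y; rewrite fct_sumE.
  apply: (convex_sum_bound (p := p ^~ y) (u := fun z => v z y)) => // z pz.
  rewrite -[v z y]/(f y * (beta z - beta y)) cabsM; apply: ler_pM => //.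
  - exact: cabs_ge0.
  - exact: cabs_ge0.
  - by apply: le_trans (beta_lip z y) _; rewrite ler_wpM2l// ltW// pd.
have ccf : continuous (c%:C *: f) := @continuousZC _ _ c%:C f cf.
have -> : c * cabs (Lam f) = cabs (Lam (c%:C *: f - Fd) + Lam Fd).
  rewrite (LamB _ _ ccf cFd) subrK.
  have c0' := @continuous_constC R K 0.
  have := LamL c%:C f _ cf c0'; have := LamB f f cf cf; rewrite !subrr => Lam0.
  by rewrite Lam0 !addr0 => ->; rewrite cabsM cabs_real gtr0_norm.
apply: le_trans (cabsD _ _) _; apply: lerD => //.
exact: (LamC _ _ (continuousDC ccf (continuousNC cFd)) near_f).
Qed.

End KernelFunctional.

(** * Accessibility and intertwining maps *)

Section AccessibleFromIntertwiners.
Context {R : realType} {G : topGroupType} {K : ptopologicalType}.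
Variables (act : G -> K -> K) (mu : probability (borel K) R).
Hypotheses (cG : compact [set: G]) (homK : homogeneous_space act).
Hypothesis inv : invariant_measure act mu.
Variable S : set (K -> R[i]).
Hypotheses (Sfin : finite_dim_subspace S) (Scont : forall f, S f -> continuous f).

Let cK : compact [set: K] := hs_compact homK.

Let Ssub : subspace_set S := finite_dim_is_subspace Sfin.

Lemma L2inner_product_on : inner_product_on S (L2inner mu).
Proof. exact: inner_product_on_sub Scont (L2inner_product homK inv). Qed.

(** The projection is the Riesz vector of the functional s |-> <s, f> on S. *)
Lemma orthogonal_projection_exists f : continuous f ->
  exists2 t, S t & forall s, S s -> L2inner mu (f - t) s = 0.
Proof.
move=> cf; have ipC := L2inner_product homK inv.
have [|t St tE] := riesz_finite_dim Ssub L2inner_product_on Sfin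
    (phi := fun s => L2inner mu s f).
  by move=> a u v Su Sv; exact: (ip_linear ipC a (Scont Su) (Scont Sv) cf).
have ct := Scont St; exists t => // s Ss; have cs := Scont Ss.
have sub := @continuous_subspace R K.
by rewrite (ipBl sub ipC cf ct cs) (ip_conj ipC cf cs) tE// -(ip_conj ipC ct cs) subrr.
Qed.

Lemma sup_norm_le (h : K -> R[i]) H : (forall x, cabs (h x) <= H) ->
  sup_norm h <= H.
Proof.
by move=> hH; apply: ge_sup => [|_ [y _ <-]]; [exists (cabs (h point)), point|
  exact: hH].
Qed.

Lemma sup_norm_ge (h : K -> R[i]) x : continuous h -> cabs (h x) <= sup_norm h.
Proof.
move=> ch; have [N _ hN] := continuous_bounded cK ch.
apply: sup_upper_bound; last by exists x.
by split; [exists (cabs (h point)), point|exists N => _ [y _ <-]; exact: hN].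
Qed.

Lemma projection_sup_bound Q : bounded_projection S Q ->
  exists2 M : R, 0 <= M & forall h (H : R), continuous h ->
    (forall x, cabs (h x) <= H) -> forall x, cabs (Q h x) <= M * H.
Proof.
(* The given bound [M] may be negative. *)
move=> [QS _ [M QM] _]; exists `|M|; first exact: normr_ge0.
move=> h H ch hH x; have cQh := Scont (QS _ ch).
apply: le_trans (sup_norm_ge x cQh) _; apply: le_trans (QM _ ch) _.
have h0 : 0 <= sup_norm h := le_trans (cabs_ge0 _) (sup_norm_ge x ch).
apply: (@le_trans _ _ (`|M| * sup_norm h)); first by rewrite ler_wpM2r// ler_norm.
by rewrite ler_wpM2l// sup_norm_le.
Qed.

(* The functional [f |-> <Q f, s>] is the limit of the pairings with the
   functions [y |-> <s, Q (k y)>], [k y] being a kernel function; these belong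
   to [S] since they depend equivariantly on [s]. *)
Lemma intertwiners_accessible :
  (forall B : (K -> R[i]) -> K -> R[i],
    (forall a u v, S u -> S v -> B (a *: u + v) = a *: B u + B v) ->
    (forall g s, S s -> B (left_translate act g s) = left_translate act g (B s)) ->
    (forall s, S s -> continuous (B s)) -> forall s, S s -> S (B s)) ->
  G_accessible act mu S.
Proof.
move=> clS Q projQ eqQ; have [QS QL _ Qid] := projQ.
have [M M0 QM] := projection_sup_bound projQ.
have ipC := L2inner_product homK inv; have sub := @continuous_subspace R K.
have cQ h : continuous h -> continuous (Q h) by move=> ch; exact/Scont/QS.
have QB u v : continuous u -> continuous v -> Q (u - v) = Q u - Q v.
  move=> cu cv; have := QL (-1) v u cv cu.
  by rewrite !scaleN1r [- v + u]addrC [- Q v + _]addrC.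
(* Subtracting from f its orthogonal projection, which [Q] fixes, reduces to f orthogonal to S. *)
suff Q0 f : continuous f -> (forall s, S s -> L2inner mu f s = 0) ->
    forall s, S s -> L2inner mu (Q f) s = 0.
  move=> f cf; split; first exact: QS.
  have [t St tP] := orthogonal_projection_exists cf; have ct := Scont St.
  have cft : continuous (f - t) := continuousDC cf (continuousNC ct).
  move=> s Ss; have cs := Scont Ss.
  have := Q0 _ cft tP s Ss; rewrite (QB f t cf ct) (Qid t St).
  have := tP s Ss; have cQf := cQ _ cf.
  rewrite (ipBl sub ipC cf ct cs) (ipBl sub ipC cQf ct cs) (ipBl sub ipC cf cQf cs).
  move=> /eqP; rewrite subr_eq0 => /eqP ->.
  by move=> /eqP; rewrite subr_eq0 => /eqP ->; rewrite subrr.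
move=> cf fS s0 Ss0.
have Lam_bound s (N : R) : S s -> (forall x, cabs (s x) <= N) ->
    forall u (H : R), continuous u -> (forall x, cabs (u x) <= H) ->
    cabs (L2inner mu (Q u) s) <= N * M * H.
  move=> Ss sN u H cu uH; rewrite -mulrA [leRHS]mulrC.
  by apply: (L2inner_bound mu homK (cQ _ cu) (Scont Ss)) => // x; exact: QM.
have Lam_linear s a u v : S s -> continuous u -> continuous v ->
    L2inner mu (Q (a *: u + v)) s = a * L2inner mu (Q u) s + L2inner mu (Q v) s.
  move=> Ss cu cv; rewrite (QL a u v cu cv).
  exact: (ip_linear ipC a (cQ _ cu) (cQ _ cv) (Scont Ss)).
have [N N0 s0N] := continuous_bounded cK (Scont Ss0).
apply: (functional_eq0 cG homK inv cf (Lam := fun h => L2inner mu (Q h) s0)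
  (mulr_ge0 N0 M0)) => [a u v cu cv|u H cu uH|e e0].
- exact: Lam_linear.
- exact: Lam_bound.
pose B s y := L2inner mu s (Q (kern_fun act f e y)).
have ck y : continuous (kern_fun act f e y) by exact: kern_fun_continuous.
have cQk y := cQ _ (ck y).
have BE y s : S s -> B s y = (L2inner mu (Q (kern_fun act f e y)) s)^*%C.
  by move=> Ss; exact: (ip_conj ipC (Scont Ss) (cQk y)).
have SB : S (B s0).
  apply: (clS B _ _ _ s0 Ss0).
  - move=> a u v Su Sv; apply/funext => y.
    exact: (ip_linear ipC a (Scont Su) (Scont Sv) (cQk y)).
  (* <L_g s, Q k_y> = <s, L_{g^-1} Q k_y> = <s, Q k_{g^-1 y}>, by equivariance of [Q] and invariance
     of the kernel. *)
  - move=> g s Ss; apply/funext => y; rewrite /left_translate /B.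
    rewrite (L2inner_translateV homK inv g (Scont Ss) (cQk y)).
    by rewrite -(eqQ _ _ (ck y)) kern_fun_act.
  - move=> s Ss; have [Ns Ns0 sN] := continuous_bounded cK (Scont Ss).
    apply: (lipschitz_continuousC cG homK cf (mulr_ge0 Ns0 M0)) => y z.
    have cabsBJ (a b : R[i]) : cabs (a^*%C - b^*%C) = cabs (a - b).
      by rewrite -[RHS]cabsJ rmorphB.
    rewrite (BE y s Ss) (BE z s Ss) cabsBJ.
    have cN := continuousNC (ck z).
    have := Lam_linear s (-1) _ _ Ss (ck z) (ck y).
    rewrite mulN1r scaleN1r addrC [- L2inner _ _ _ + _]addrC => <-.
    apply: (Lam_bound _ _ Ss sN); first exact: (continuousDC (ck y) cN).
    by move=> x; exact: kern_fun_lipschitz.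
have := fS _ SB; rewrite L2innerE => <-; congr Cintegral; apply/funext => y.
by rewrite BE// conjcK.
Qed.

End AccessibleFromIntertwiners.

Section IsotypicSumAccessible.
Context {R : realType} {G : topGroupType} {K : ptopologicalType}.
Variables (act : G -> K -> K) (mu : probability (borel K) R).
Hypotheses (cG : compact [set: G]) (homK : homogeneous_space act).
Hypothesis inv : invariant_measure act mu.
Variable S : set (K -> R[i]).
Hypotheses (Sfin : finite_dim_subspace S) (Scont : forall f, S f -> continuous f).
Hypothesis Sinv : G_invariant act S.

Let Ssub : subspace_set S := finite_dim_is_subspace Sfin.

(** It suffices to test [B] on matrix coefficients: [B] after a coefficient map intertwines the same
    representation, so its values lie in the same component. *)
Lemma isotypic_sum_accessible (I : Type) (Ghat : I -> unitary_rep R G) x0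
    (Lambda : set I) : (forall i, irreducible (Ghat i)) ->
  S = linear_span (\bigcup_(i in Lambda) isotypic_component act x0 (Ghat i)) ->
  G_accessible act mu S.
Proof.
move=> irr SE; apply: (intertwiners_accessible cG homK inv Sfin Scont).
move=> B BL BE _ s Ss.
pose W := [set h | S h /\ S (B h)].
have B0 : B 0 = 0.
  have := BL (-1) 0 0 Ssub.1 Ssub.1.
  by rewrite scaler0 addr0 scaleN1r addNr.
have Wsub : subspace_set W.
  split=> [|a u v [Su SBu] [Sv SBv]]; first by split; rewrite ?B0; exact: Ssub.1.
  by split; [exact: Ssub.2|rewrite BL//; exact: Ssub.2].
have comp_S i : Lambda i -> isotypic_component act x0 (Ghat i) `<=` S.
  by move=> Li h hi; rewrite SE; apply: sub_linear_span; exists i.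
suff SW : S `<=` W by case: (SW s Ss).
rewrite {1}SE; apply: (linear_span_min Wsub) => h [i Li].
apply: (linear_span_min Wsub) => {}h [u [v [fu /(eq_matrix_coef homK fu) ->]]].
have coefS w : S (matrix_coef act x0 u w).
  exact/(comp_S i Li)/matrix_coef_isotypic.
have [cL cE] := matrix_coef_intertwines homK fu.
(* For u = 0 the coefficient map is zero and gives no embedding from which to get the finite
   dimension. *)
split=> //; have [u0|u0] := eqVneq u 0.
  by rewrite u0 matrix_coef0 B0; exact: Ssub.1.
have Vfin := finite_dim_inj Sfin cL (matrix_coef_inj homK fu (irr i) u0) coefS.
have BcoefI : intertwines act (fun w => B (matrix_coef act x0 u w)).
  by split=> [a y z|g w]; [rewrite cL BL|rewrite cE BE].
exact: (comp_S i Li _ (intertwines_isotypic x0 v Vfin BcoefI)).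
Qed.

Let ipC := L2inner_product homK inv.
Let ipS := L2inner_product_on homK inv Scont.
Let Csub := @continuous_subspace R K.

(** Supplies the sup-norm bound for the projection built in [accessible_intertwines], a finite-rank
    operator. *)
Lemma finite_rank_bound n (a b : 'I_n -> K -> R[i]) :
  (forall i, continuous (a i)) -> (forall i, continuous (b i)) ->
  exists2 M : R, 0 <= M & forall f (H : R), continuous f ->
    (forall x, cabs (f x) <= H) ->
    forall x, cabs ((\sum_i L2inner mu f (a i) *: b i) x) <= M * H.
Proof.
have cK := hs_compact homK; move=> ca cb.
have /choice[A aA] i : exists M : R, 0 <= M /\ forall x, cabs (a i x) <= M.
  by have [M ? ?] := continuous_bounded cK (ca i); exists M.
have /choice[B bB] i : exists M : R, 0 <= M /\ forall x, cabs (b i x) <= M.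
  by have [M ? ?] := continuous_bounded cK (cb i); exists M.
exists (\sum_i A i * B i).
  by apply: sumr_ge0 => i _; rewrite mulr_ge0//; [case: (aA i)|case: (bB i)].
move=> f H cf fH x; rewrite fct_sumE; apply: le_trans (cabs_sum _ _) _.
rewrite mulr_suml; apply: ler_sum => i _.
rewrite -[X in cabs X]/(L2inner mu f (a i) * b i x) cabsM mulrAC [A i * H]mulrC.
apply: ler_pM; rewrite ?cabs_ge0//; last by case: (bB i).
by apply: (L2inner_bound mu homK cf (ca i)) => //; case: (aA i).
Qed.

(* If [P] is the orthogonal projection and [Psi = Phi - P Phi], then [P] plus
   [U] composed with the adjoint of [Psi] is again an equivariant projection
   onto [S]; accessibility forces [Psi = 0]. *)
Lemma accessible_intertwines pi (U Phi : rep_space pi -> K -> R[i]) v :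
  G_accessible act mu S -> finite_dim_subspace [set: rep_space pi] ->
  intertwines act U -> injective U -> (forall w, S (U w)) ->
  intertwines act Phi -> (forall w, continuous (Phi w)) -> S (Phi v).
Proof.
move=> accS Vfin [UL UE] Uinj US [PhiL PhiE] cPhi.
have ipH := inner_inner_product (rep_space pi).
have sH := @setT_subspace _ (rep_space pi).
have [n [e [Se oe eE]]] := orthonormal_basis Ssub ipS Sfin.
have [m [b [_ ob bE]]] := orthonormal_basis sH ipH Vfin.
have ce i := Scont (Se i).
pose P f := \sum_i L2inner mu f (e i) *: e i.
have SP f : S (P f).
  by apply: subspace_set_sum => // i _; exact: subspace_setZ.
have cP f := Scont (SP f).
have PE f s : continuous f -> S s -> L2inner mu (P f) s = L2inner mu f s.
  move=> cf Ss; rewrite {2}[s]eE// (ip_sumr Csub ipC)//.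
  rewrite (ip_suml Ssub ipS)//; apply: eq_bigr => i _.
  by rewrite mulrC (ip_conj ipS).
have P_id s : S s -> P s = s by move=> Ss; rewrite {2}[s]eE.
have P_linear a f h : continuous f -> continuous h -> P (a *: f + h) = a *: P f + P h.
  move=> cf ch; rewrite /P scaler_sumr -big_split/=; apply: eq_bigr => i _.
  by rewrite (ip_linear ipC a cf ch (ce i)) scalerDl scalerA.
have PT g f : continuous f -> P (left_translate act g f) = left_translate act g (P f).
  move=> cf; apply: (ip_inj Ssub ipS) => //; first exact: Sinv.
  move=> s Ss; have cs := Scont Ss.
  rewrite (PE _ _ (@left_translate_continuous _ _ _ _ homK g f cf) Ss).
  rewrite (L2inner_translateV homK inv g cf cs).
  rewrite (L2inner_translateV homK inv g (cP f) cs).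
  by rewrite PE//; exact: Sinv.
pose Psi w := Phi w - P (Phi w).
have cPsi w : continuous (Psi w) := continuousDC (cPhi w) (continuousNC (cP (Phi w))).
have PsiS w s : S s -> L2inner mu (Psi w) s = 0.
  move=> Ss; rewrite (ipBl Csub ipC (cPhi w) (cP _) (Scont Ss)).
  by rewrite PE// subrr.
have PsiL : linear_map Psi.
  move=> a y z; rewrite /Psi PhiL P_linear//.
  by rewrite opprD addrACA scalerBr.
have PsiE g w : Psi (pi g w) = left_translate act g (Psi w).
  by rewrite /Psi PhiE PT.
(* [t] is the adjoint of [Psi], written in the basis [b]. *)
pose t f := \sum_k L2inner mu f (Psi (b k)) *: b k.
have tE f w : continuous f -> inner (t f) w = L2inner mu f (Psi w).
  move=> cf; rewrite {2}[w]bE// (linear_map_sum _ _ PsiL).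
  under [in RHS]eq_bigr do rewrite (linear_mapZ _ _ PsiL).
  rewrite (ip_sumr Csub ipC (fun k => inner w (b k)) (fun k => cPsi (b k)) cf).
  rewrite (ip_suml sH ipH)//.
  by apply: eq_bigr => k _; rewrite mulrC (ip_conj ipH).
have t_linear a f h : continuous f -> continuous h -> t (a *: f + h) = a *: t f + t h.
  move=> cf ch; rewrite /t scaler_sumr -big_split/=; apply: eq_bigr => k _.
  by rewrite (ip_linear ipC a cf ch (cPsi (b k))) scalerDl scalerA.
have tT g f : continuous f -> t (left_translate act g f) = pi g (t f).
  move=> cf; apply: (ip_inj sH ipH) => // w _; rewrite rep_innerV.
  rewrite (tE _ _ (@left_translate_continuous _ _ _ _ homK g f cf)) (tE _ _ cf) PsiE.
  exact: (L2inner_translateV homK inv g cf (cPsi w)).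
have tS s : S s -> t s = 0.
  move=> Ss; rewrite /t big1// => k _; have cs := Scont Ss.
  by rewrite (ip_conj ipC cs (cPsi _)) (PsiS _ _ Ss) conjc0 scale0r.
pose Q f := P f + U (t f).
have cU w := Scont (US w).
have projQ : bounded_projection S Q.
  split.
  - by move=> f _; exact: (subspace_setD Ssub (SP f) (US (t f))).
  - move=> a f h cf ch; rewrite /Q (P_linear a f h cf ch) (t_linear a f h cf ch) UL.
    by rewrite scalerDr addrACA.
  - have [M1 M10 P1] := finite_rank_bound ce ce.
    have [M2 M20 P2] := finite_rank_bound (fun k => cPsi (b k)) (fun k => cU (b k)).
    exists (M1 + M2) => f cf; apply: sup_norm_le => x.
    rewrite mulrDl; apply: le_trans (cabsD _ _) _.
    have fn y : cabs (f y) <= sup_norm f := sup_norm_ge homK y cf.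
    apply: lerD; first exact: P1.
    have -> : U (t f) = \sum_k L2inner mu f (Psi (b k)) *: U (b k).
      rewrite (linear_map_sum _ _ UL); apply: eq_bigr => k _.
      exact: (linear_mapZ _ _ UL).
    exact: P2.
  - by move=> s Ss; rewrite /Q (P_id s Ss) (tS s Ss) (linear_map0 UL) addr0.
have eqQ : equivariant act Q.
  by move=> g f cf; rewrite /Q (PT g f cf) (tT g f cf) UE.
have Ut0 f : continuous f -> t f = 0.
  move=> cf; apply: Uinj; rewrite (linear_map0 UL); apply: (ip_eq0 ipS (US _)).
  (* Pair f - Q f with U (t f): there f and P f contribute the same, so only - <U (t f), U (t f)>
     remains. *)
  have [_ /(_ _ (US (t f)))] := accS Q projQ eqQ f cf.
  have cQf : continuous (Q f) := continuousDC (cP f) (cU (t f)).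
  rewrite (ipBl Csub ipC cf cQf (cU _)) (ipDl ipC (cP f) (cU _) (cU _)).
  rewrite (PE _ _ cf (US _)).
  by rewrite opprD addrA subrr sub0r => /eqP; rewrite oppr_eq0 => /eqP.
have Psi0 : Psi v = 0.
  (* <Psi v, Psi v> = <t (Psi v), v>. *)
  apply: (ip_eq0 ipC (cPsi v)); rewrite -(tE _ _ (cPsi v)) Ut0//.
  exact: (ip0l sH ipH).
by rewrite -[Phi v](subrK (P (Phi v))) -/(Psi v) Psi0 add0r.
Qed.

End IsotypicSumAccessible.

(** * Subrepresentations as unitary representations *)

Section CauchySchwarz.
Context {R : realType} {E : lmodType R[i]}.
Variables (W : set E) (ip : E -> E -> R[i]).
Hypotheses (Wsub : subspace_set W) (ipW : inner_product_on W ip).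

Lemma ip_CauchySchwarz u v : W u -> W v -> 
  (cabs (ip u v) ^+ 2)%:C <= ip u u * ip v v.
Proof.
move=> Wu Wv; have [->|v0] := eqVneq v 0.
  by rewrite (ip0r Wsub ipW Wu) (ip0r Wsub ipW Wsub.1) cabs0 expr0n mulr0.
set a := ip u u; set d := ip v v; set b := ip u v.
have bJ : ip v u = b^*%C by exact: ip_conj ipW _ _ Wv Wu.
have dJ : d^*%C = d by rewrite -(ip_conj ipW).
have d0 : 0 < d.
  rewrite lt_neqAle (ip_ge0 ipW)// andbT eq_sym.
  by apply: contra_neq v0 => /(ip_eq0 ipW); exact.
have Wdu := subspace_setZ d Wsub Wu; have Wbv := subspace_setZ b Wsub Wv.
(* The vector d u - b v replaces u - (b / d) v to avoid division; its square norm is d (a d -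
   |b|^2). *)
have := ip_ge0 ipW (subspace_setB Wsub Wdu Wbv).
have Ww := subspace_setB Wsub Wdu Wbv.
rewrite (ipBl Wsub ipW)// !(ipBr Wsub ipW)// !(ipZl Wsub ipW)// !(ipZr Wsub ipW)//.
rewrite bJ dJ -/a -/b -/d.
have -> : d * (d * a) - d * (b^*%C * b) - (b * (d * b^*%C) - b * (b^*%C * d)) =
  d * (a * d - b * b^*%C) by ring.
by rewrite pmulr_rge0// subr_ge0 rmorphXn/= -cabsE sqr_normc.
Qed.

Lemma ip_triangle u v (r s : R) : W u -> W v -> 0 <= r -> 0 <= s ->
  ip u u = (r ^+ 2)%:C -> ip v v = (s ^+ 2)%:C ->
  ip (u + v) (u + v) <= ((r + s) ^+ 2)%:C.
Proof.
move=> Wu Wv r0 s0 uu vv; have Wuv := subspace_setD Wsub Wu Wv.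
rewrite (ipDl ipW)// !(ipDr Wsub ipW)// uu vv (ip_conj ipW Wv Wu).
set b := ip u v.
have CS : cabs b <= r * s.
  rewrite -(@ler_pXn2r _ 2)// ?nnegrE ?cabs_ge0 ?mulr_ge0//.
  have rsE : ((r * s) ^+ 2)%:C = ip u u * ip v v by rewrite uu vv exprMn rmorphM.
  rewrite -lecR rsE.
  exact: ip_CauchySchwarz.
have -> : (r ^+ 2)%:C + b + (b^*%C + (s ^+ 2)%:C) =
    (r ^+ 2 + s ^+ 2)%:C + (b + b^*%C) by rewrite rmorphD/=; ring.
rewrite addcJ; have -> : (2 : R[i]) = (2 : R)%:C by rewrite rmorph_nat.
rewrite -rmorphM/= -rmorphD/= lecR.
have := le_trans (ler_norm _) (le_trans (cabs_ge_Re b) CS); nra.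
Qed.

End CauchySchwarz.

(** A separate name for row vectors, to carry the Euclidean norm instead of the maximum norm of
    matrices. *)
Definition euclid (R : realType) (n : nat) : Type := 'rV[R[i]]_n.

HB.instance Definition _ (R : realType) (n : nat) :=
  GRing.Lmodule.copy (euclid R n) 'rV[R[i]]_n.

Section Euclid.
Context {R : realType} {n : nat}.
Implicit Types x y : euclid R n.

Definition euclid_inner x y : R[i] := \sum_i x 0 i * (y 0 i)^*%C.

Definition euclid_norm x : R := Num.sqrt (\sum_i cabs (x 0 i) ^+ 2).

Lemma euclid_norm_ge0 x : 0 <= euclid_norm x.
Proof. exact: sqrtr_ge0. Qed.

Lemma euclid_innerxx x : euclid_inner x x = (euclid_norm x ^+ 2)%:C.
Proof.
rewrite sqr_sqrtr; last by apply: sumr_ge0 => i _; exact: sqr_ge0.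
rewrite rmorph_sum/=; apply: eq_bigr => i _.
by rewrite rmorphXn/= -cabsE sqr_normc.
Qed.

Lemma euclid_inner_product : inner_product_on [set: euclid R n] euclid_inner.
Proof.
split=> [a u v w _ _ _|u v _ _|v _|v _].
- rewrite /euclid_inner mulr_sumr -big_split; apply: eq_bigr => i _.
  by rewrite !mxE mulrDl mulrA.
- rewrite /euclid_inner rmorph_sum/=; apply: eq_bigr => i _.
  by rewrite rmorphM/= conjcK mulrC.
- by rewrite euclid_innerxx ler0c sqr_ge0.
- move=> /eqP; rewrite /euclid_inner psumr_eq0 => [/allP v0|i _].
    apply/rowP => i; have := v0 i (mem_index_enum _).
    by rewrite mulf_eq0 conjc_eq0 orbb mxE => /eqP.
  exact: mulcJ_ge0.
Qed.

Lemma euclid_norm_coord x i : cabs (x 0 i) <= euclid_norm x.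
Proof.
rewrite -[leLHS]ger0_norm ?cabs_ge0// -sqrtr_sqr ler_wsqrtr//.
rewrite (bigD1 i)//= lerDl; apply: sumr_ge0 => j _; exact: sqr_ge0.
Qed.

Lemma euclid_norm_le_sum x : euclid_norm x <= \sum_i cabs (x 0 i).
Proof.
have s0 : 0 <= \sum_i cabs (x 0 i) by apply: sumr_ge0 => i _; exact: cabs_ge0.
rewrite -[leRHS]ger0_norm// -sqrtr_sqr ler_wsqrtr//.
pose P (a b : R) := 0 <= b /\ a <= b ^+ 2.
suff [] : P (\sum_i cabs (x 0 i) ^+ 2) (\sum_i cabs (x 0 i)) by [].
elim/big_ind2 : _ => [|a b c d [b0 ab] [d0 cd]|i _]; rewrite /P.
- by rewrite expr0n.
- by split; [exact: addr_ge0|nra].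
- by rewrite cabs_ge0.
Qed.

Let normC x : R[i] := (euclid_norm x)%:C.

Let normCD x y : normC (x + y) <= normC x + normC y.
Proof.
rewrite /normC -rmorphD/= lecR -(@ler_pXn2r _ 2)// ?nnegrE
  ?addr_ge0 ?euclid_norm_ge0//.
rewrite -lecR -euclid_innerxx.
apply: (ip_triangle _ euclid_inner_product) => //;
  rewrite ?euclid_innerxx// ?euclid_norm_ge0//.
Qed.

Let normCZ a x : normC (a *: x) = `|a| * normC x.
Proof.
rewrite /normC cabsE -rmorphM/=; congr (_%:C); rewrite /euclid_norm.
under eq_bigr do rewrite mxE cabsM exprMn.
by rewrite -mulr_sumr sqrtrM ?sqr_ge0// sqrtr_sqr ger0_norm ?cabs_ge0.
Qed.

Let normC0_eq0 x : normC x = 0 -> x = 0.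
Proof.
move=> /complexI x0; apply: (ip_eq0 euclid_inner_product) => //.
by rewrite euclid_innerxx x0 expr0n.
Qed.

HB.instance Definition _ :=
  Lmodule_isNormed.Build R[i] (euclid R n) normCD normCZ normC0_eq0.

Lemma euclid_normE x : `|x| = (euclid_norm x)%:C.
Proof. by []. Qed.

End Euclid.

Section EuclidHilbert.
Context {R : realType} {n : nat}.

(** Completeness of [R] is applied to the real and imaginary parts of each coordinate. *)
Let euclid_complete (F : set_system (euclid R n)) :
  ProperFilter F -> cauchy F -> cvg F.
Proof.
move=> FF /cauchy_ballP Fc.
have Fcoord (phi : R[i] -> R) i : (forall z w, phi (z - w) = phi z - phi w) ->
    (forall z, `|phi z| <= cabs z) -> cvg ((fun x : euclid R n => phi (x 0 i)) @ F).
  move=> phiB phi_le; apply: cauchy_cvg; apply/cauchy_ballP => e e0.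
  have e0C : 0 < e%:C by rewrite ltcR.
  have H := Fc _ e0C; rewrite !near_simpl.
  case: H => [[A B] [/= FA FB] AB]; exists (A, B) => //= -[x y] [/= Ax By].
  have := AB (x, y) (conj Ax By); rewrite -!ball_normE/= euclid_normE ltcR.
  apply: le_lt_trans; rewrite -phiB; apply: le_trans (phi_le _) _.
  by have := euclid_norm_coord (x - y) i; rewrite !mxE.
have reC i : cvg ((fun x : euclid R n => complex.Re (x 0 i)) @ F).
  by apply: Fcoord => [[a b] [c d]|z] //; exact: cabs_ge_Re.
have imC i : cvg ((fun x : euclid R n => complex.Im (x 0 i)) @ F).
  by apply: Fcoord => [[a b] [c d]|z] //; exact: cabs_ge_Im.
have /choice[re reE] i :
    exists l : R, complex.Re ((x : euclid R n) 0 i) @[x --> F] --> l.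
  by have /cvg_ex := reC i.
have /choice[im imE] i :
    exists l : R, complex.Im ((x : euclid R n) 0 i) @[x --> F] --> l.
  by have /cvg_ex := imC i.
pose l : euclid R n := \row_i (re i +i* im i).
apply/cvg_ex; exists l; apply/cvgrPdist_lt => -[e e'].
rewrite ltcE/= => /andP[/eqP -> e0].
(* Dividing by [n.+1] covers n = 0 and keeps the sum of [n] terms strictly below [e]; the half is
   for real and imaginary parts. *)
have d0 : 0 < e / n.+1%:R / 2 by rewrite !divr_gt0.
have near_coord i : \forall x \near F,
    cabs (l 0 i - (x : euclid R n) 0 i) < e / n.+1%:R.
  have /cvgrPdist_lt /(_ _ d0) Hr := reE i.
  have /cvgrPdist_lt /(_ _ d0) Hi := imE i.
  apply: filterS2 Hr Hi => x; rewrite mxE; case: (x 0 i) => a b /= Ha Hb.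
  have -> : (re i +i* im i) - (a +i* b) = (re i - a)%:C + 'i%C * (im i - b)%:C.
    by apply/eqP; rewrite eq_complex/= !mul0r !mul1r !subr0 !addr0 !add0r !eqxx.
  apply: le_lt_trans (cabsD _ _) _; rewrite cabsM !cabs_real.
  by rewrite cabs_i mul1r (splitr (e / n.+1%:R)); exact: ltrD.
apply: (@filterS _ F _ _ _ _ (filter_forall _ near_coord)) => x xl.
rewrite euclid_normE ltcR; apply: le_lt_trans (euclid_norm_le_sum _) _.
apply: (@le_lt_trans _ _ (\sum_(i < n) e / n.+1%:R)).
  by apply: ler_sum => i _; have := xl i; rewrite !mxE => /ltW.
rewrite sumr_const card_ord -[_ *+ n]mulr_natr mulrAC ltr_pdivrMr ?ltr0n//.
by rewrite ltr_pM2l// ltr_nat.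
Qed.

HB.instance Definition _ := Uniform_isComplete.Build (euclid R n) euclid_complete.

Let euclid_inner_norm (v : euclid R n) : euclid_inner v v = `|v| ^+ 2.
Proof. by rewrite euclid_innerxx euclid_normE rmorphXn. Qed.

Let euclid_inner_linear a (u v w : euclid R n) :
  euclid_inner (a *: u + v) w = a * euclid_inner u w + euclid_inner v w.
Proof. exact: (ip_linear euclid_inner_product). Qed.

Let euclid_inner_conj (u v : euclid R n) :
  euclid_inner u v = (euclid_inner v u)^*.
Proof. exact: (ip_conj euclid_inner_product). Qed.

Definition euclid_hilbert : hilbertSpace R :=
  @HilbertSpace R (euclid R n : completeNormedModType R[i]) euclid_inner
    euclid_inner_linear euclid_inner_conj euclid_inner_norm.

End EuclidHilbert.

Section SubRepresentation.
Context {R : realType} {G : topGroupType} {K : ptopologicalType}.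
Variables (act : G -> K -> K) (mu : probability (borel K) R).
Hypotheses (homK : homogeneous_space act) (inv : invariant_measure act mu).

Let cK : compact [set: K] := hs_compact homK.

(** Compactness of K gives the uniformity in x; this yields the continuity of subrepresentations. *)
Lemma left_translate_near (f : K -> R[i]) g (e : R) : continuous f -> 0 < e ->
  \forall k \near g, forall x,
    cabs (left_translate act g f x - left_translate act k f x) < e.
Proof.
move=> cf e0; have /compact_near_coveringP cov := cK.
have e20 : 0 < e / 2 by rewrite divr_gt0.
have cF : continuous (fun p : G * K => left_translate act p.1 f p.2).
  move=> [k x]; rewrite /left_translate /=.
  have ckx : (fun p : G * K => (p.1^-1%g, p.2)) @ (k, x) --> (k^-1%g, x).
    have c1 : (fun p : G * K => p.1^-1%g) @ (k, x) --> k^-1%g.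
      apply: (@cvg_comp _ _ _ fst (fun h : G => h^-1%g) _ (nbhs k)).
        exact: cvg_fst.
      exact: invg_continuous.
    have c2 : (fun p : G * K => p.2) @ (k, x) --> x by exact: cvg_snd.
    exact: (cvg_pair c1 c2).
  have cact := cvg_comp _ _ ckx (@hs_continuous _ _ _ homK (k^-1%g, x)).
  exact: (cvg_comp _ _ cact (cf _)).
pose P k x := cabs (left_translate act g f x - left_translate act k f x) < e.
suff /(cov G (nbhs g) P _) : forall x, [set: K] x ->
    \forall x' \near x & k \near g, P k x'.
  by apply: filterS => k Pk x; exact: Pk.
move=> x _.
have [[U V] [/= gU xV] UV] := continuous_near_cabs (g, x) cF e20.
exists (V, U) => //= -[x' k] [/= Vx' Uk].
rewrite /P/= -(subrKA (left_translate act g f x)) (splitr e).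
apply: le_lt_trans (cabsD _ _) _; apply: ltrD; last exact: (UV (k, x')).
by rewrite cabsB; apply: (UV (g, x')); split=> //=; exact: nbhs_singleton.
Qed.

Variable W : set (K -> R[i]).
Hypotheses (Wfin : finite_dim_subspace W) (Wcont : forall f, W f -> continuous f).
Hypothesis Winv : G_invariant act W.

(** A representation needs a Hilbert space as a type, while [W] is a set of functions; so the action
    is transported to C^n along an orthonormal basis. *)
Lemma subrepresentation :
  exists (pi : unitary_rep R G) (U : rep_space pi -> K -> R[i]),
  [/\ intertwines act U, forall v w, L2inner mu (U v) (U w) = inner v w,
      forall v, W (U v) & forall s, W s -> exists v, U v = s].
Proof.
have Wsub := finite_dim_is_subspace Wfin.
have ipC := L2inner_product homK inv.
have ipW := L2inner_product_on homK inv Wcont.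
have Csub := @continuous_subspace R K.
have [n [e [We oe eE]]] := orthonormal_basis Wsub ipW Wfin.
pose U (a : euclid R n) : K -> R[i] := lincomb e a.
have UL : linear_map U by move=> a u v; exact: lincomb_linear.
have WU a : W (U a) by exact: lincomb_in.
have UI a b : L2inner mu (U a) (U b) = euclid_inner a b.
  rewrite {1}/U/lincomb (ip_suml Wsub ipW)//; apply: eq_bigr => i _.
  congr (_ * _); rewrite (ip_conj ipW)//; congr (_^*%C).
  exact: (orthonormal_coef Wsub ipW (b 0) i We oe).
have Uinj : injective U.
  move=> a b ab; apply/rowP => i.
  rewrite -(orthonormal_coef Wsub ipW (a 0) i We oe).
  rewrite -(orthonormal_coef Wsub ipW (b 0) i We oe).
  by congr L2inner; exact: ab.
pose rep g (a : euclid R n) : euclid R n :=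
  \row_i L2inner mu (left_translate act g (U a)) (e i).
have Urep g a : U (rep g a) = left_translate act g (U a).
  rewrite [RHS]eE; last exact: Winv.
  by apply: eq_bigr => i _; rewrite mxE.
have repL g (a : R[i]) v w : rep g (a *: v + w) = a *: rep g v + rep g w.
  by apply: Uinj; rewrite Urep !UL !Urep.
have repI g v w : euclid_inner (rep g v) (rep g w) = euclid_inner v w.
  rewrite -!UI !Urep.
  exact: (L2inner_translate homK inv g (Wcont (WU v)) (Wcont (WU w))).
have rep1 v : rep 1%g v = v.
  by apply: Uinj; rewrite Urep (left_translate1 homK).
have repM g h v : rep (g * h)%g v = rep g (rep h v).
  by apply: Uinj; rewrite !Urep (left_translateM homK).
have repc v : continuous (fun g => rep g v : @euclid_hilbert R n).
  move=> g; apply/cvgrPdist_lt => -[d d']; rewrite ltcE/= => /andP[/eqP -> d0].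
  have d20 : 0 < d / 2 by rewrite divr_gt0.
  have := left_translate_near g (Wcont (WU v)) d20.
  apply: filterS => k near_k; rewrite [Num.norm _]euclid_normE ltcR.
  apply: (@le_lt_trans _ _ (d / 2)); last by rewrite ltr_pdivrMr// ltr_pMr// ltr1n.
  rewrite -(@ler_pXn2r _ 2)// ?nnegrE ?euclid_norm_ge0//; last exact: ltW.
  have cD := Wcont (WU (rep g v - rep k v)).
  have bD x : cabs (U (rep g v - rep k v) x) <= d / 2.
    by rewrite (linear_mapB _ _ UL) !Urep; exact: (ltW (near_k x)).
  (* As [mu] has mass 1, the sup norm dominates the norm of L_2. *)
  have := L2inner_bound mu homK cD cD bD bD.
  rewrite UI euclid_innerxx cabs_real -expr2 ger0_norm//.
  exact: sqr_ge0.
pose pi := @UnitaryRep R G (@euclid_hilbert R n) rep repL repI rep1 repM repc.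
exists pi, U; split=> //.
move=> s Ws; exists (\row_i L2inner mu s (e i)).
by rewrite [RHS]eE//; apply: eq_bigr => i _; rewrite mxE.
Qed.

End SubRepresentation.

(** * Schur's lemma and the isotypic decomposition *)

Section Schur.
Context {R : realType} {G : topGroupType}.
Variables pi sigma : unitary_rep R G.
Hypotheses (irr_pi : irreducible pi) (irr_sigma : irreducible sigma).
Hypothesis Vfin : finite_dim_subspace [set: rep_space pi].

Let ipV := inner_inner_product (rep_space pi).
Let ipW := inner_inner_product (rep_space sigma).
Let sV := @setT_subspace _ (rep_space pi).
Let sW := @setT_subspace _ (rep_space sigma).

(* Some eigenspace of [A^* A] is nonzero, hence everything, so [A] is a multiple
   of an isometry; the orthogonal complement of its range is closed and
   invariant, hence zero. *)
Lemma schur_equivalent (A : rep_space pi -> rep_space sigma) :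
  linear_map A -> (forall g v, A (pi g v) = sigma g (A v)) ->
  (exists v, A v != 0) -> unitarily_equivalent pi sigma.
Proof.
move=> AL AE [v1 Av1]; have [n [e [_ oe eE]]] := orthonormal_basis sV ipV Vfin.
have n_gt0 : (0 < n)%N.
  case: n e oe eE => // e oe eE; move: Av1.
  by rewrite (eE v1 I) big_ord0 (linear_map0 AL) eqxx.
(* The Gram matrix of the vectors [A (e k)] represents A^* A, so a left eigenvector gives an
   eigenvector [v0]. *)
pose M : 'M[R[i]]_n := \matrix_(k, l) inner (A (e k)) (A (e l)).
have [lam /eigenvalueP[a aM a0]] := eigenvalue_closed M n_gt0.
pose v0 := \sum_k a 0 k *: e k.
have v0E : forall l, inner v0 (e l) = a 0 l.
  by move=> l; exact: (orthonormal_coef sV ipV (a 0) l (fun _ => I) oe).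
have v0_neq0 : v0 != 0.
  apply: contra_neq a0 => v00; apply/rowP => l.
  by rewrite -v0E v00 mxE (ip0l sV ipV).
have v0X w : inner (A v0) (A w) = lam * inner v0 w.
  have Ae l : inner (A v0) (A (e l)) = lam * a 0 l.
    rewrite (linear_map_sum _ _ AL); under eq_bigr do rewrite (linear_mapZ _ _ AL).
    rewrite (ip_suml sW ipW)//; have /rowP/(_ l) := aM; rewrite !mxE => <-.
    by apply: eq_bigr => k _; rewrite mxE.
  have Aw : A w = \sum_l inner w (e l) *: A (e l).
    rewrite {1}(eE w I) (linear_map_sum _ _ AL); apply: eq_bigr => l _.
    exact: linear_mapZ.
  rewrite Aw (ip_sumr sW ipW)// {2}(eE w I) (ip_sumr sV ipV)// mulr_sumr.
  by apply: eq_bigr => l _; rewrite Ae v0E mulrCA.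
have /choice[t tE] w : exists t, forall v, inner (A v) (A w) = inner v t.
  have [|t _ tE] := riesz_finite_dim sV ipV Vfin (phi := fun v => inner (A v) (A w)).
    by move=> c x y _ _; rewrite AL inner_linear.
  by exists t => v; exact: tE.
(* The eigenspace of [t], which is A^* A, expressed by orthogonality conditions so that
   [closed_inner_eq0] applies. *)
pose X := [set v | forall w, inner v (t w - lam^*%C *: w) = 0].
have XE v : X v <-> forall w, inner (A v) (A w) = lam * inner v w.
  have eqv w : inner v (t w - lam^*%C *: w) = inner (A v) (A w) - lam * inner v w.
    by rewrite (ipBr sV ipV)// (ipZr sV ipV)// conjcK tE.
  split=> Xv w; first by apply/eqP; rewrite -subr_eq0 -eqv Xv.
  by rewrite eqv Xv subrr.
have XT : X = setT.
  case: irr_pi => _ /(_ X) [||g v /XE Xv|X0|//].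
  - exact: closed_inner_eq0.
  - split=> [w|c x y Xx Xy w]; first by rewrite (ip0l sV ipV).
    by rewrite inner_linear Xx Xy mulr0 addr0.
  - apply/XE => w; rewrite AE !rep_innerV -Xv AE; congr inner.
  - have : X v0 by apply/XE.
    by rewrite X0 => v00; rewrite v00 ?eqxx in v0_neq0.
have AI v w : inner (A v) (A w) = lam * inner v w.
  by apply: (XE v).1; rewrite XT.
have pos (H : hilbertSpace R) (x : H) : x != 0 -> 0 < inner x x.
  move=> x0; have ipH := inner_inner_product H.
  rewrite lt_neqAle (ip_ge0 ipH)// andbT eq_sym.
  by apply: contra_neq x0 => /(ip_eq0 ipH); exact.
have v1_neq0 : v1 != 0 by apply: contra_neq Av1 => ->; exact: linear_map0.
have lam0 : 0 < lam.
  by have := pos _ _ Av1; rewrite AI pmulr_lgt0// pos.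
(* [A] multiplies inner products by [lam], so dividing by its square root gives an isometry. *)
pose c : R[i] := sqrtC lam; have c0 : 0 < c by rewrite sqrtC_gt0.
pose ci : R[i] := c^-1.
have ciJ : ci^*%C = ci by rewrite /ci conjc_inv -(RRe_real (gtr0_real c0)) conjc_real.
have cilam : ci * (ci * lam) = 1.
  rewrite -[lam]sqrtCK -/c expr2 /ci mulrA mulrACA mulVf ?mul1r//; by rewrite gt_eqF.
exists (fun v => ci *: A v); split.
- by move=> b v w; rewrite AL scalerDr !scalerA mulrC.
- move=> v w; rewrite (ipZl sW ipW)// (ipZr sW ipW)// AI ciJ.
  by rewrite mulrA mulrA -[ci * ci * lam]mulrA cilam mul1r.
- move=> w; pose Y := [set y | forall v, inner y (A v) = 0].
  have Y0 : Y = [set 0].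
    case: irr_sigma => _ /(_ Y) [||g y Yy v|//|YT].
    + exact: closed_inner_eq0.
    + split=> [v|b x y Yx Yy v]; first by rewrite (ip0l sW ipW).
      by rewrite inner_linear Yx Yy mulr0 addr0.
    + by rewrite rep_innerV -AE.
    + have : Y (A v1) by rewrite YT.
      by move=> /(_ v1) /(ip_eq0 ipW) Av10; rewrite Av10 ?eqxx in Av1.
  (* The range is finite-dimensional, so [w] has an orthogonal projection [A v] onto it, and the
     difference lies in [Y]. *)
  have rfin := finite_dim_range AL Vfin.
  have rsub := finite_dim_is_subspace rfin.
  have ipr := inner_product_on_sub (X := range A) (fun _ _ => I) ipW.
  have [|_ [v _ <-] vE] := riesz_finite_dim rsub ipr rfin (phi := fun z => inner z w).
    by move=> b x y _ _; rewrite inner_linear.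
  exists (c *: v); rewrite (linear_mapZ _ _ AL) scalerA mulVf ?gt_eqF// scale1r.
  have : Y (w - A v).
    move=> u; rewrite (ipBl sW ipW)// inner_conj vE; last exact: imageT.
    by rewrite -inner_conj subrr.
  by rewrite Y0 => /eqP; rewrite subr_eq0 => /eqP.
- by move=> g v; rewrite AE (linear_mapZ ci (A v) (@rep_linear _ _ sigma g)).
Qed.

Section Orthogonality.
Context {K : ptopologicalType}.
Variables (act : G -> K -> K) (mu : probability (borel K) R).
Hypotheses (homK : homogeneous_space act) (inv : invariant_measure act mu).
Hypothesis Wfin : finite_dim_subspace [set: rep_space sigma].
Variables (Phi : rep_space pi -> K -> R[i]) (Psi : rep_space sigma -> K -> R[i]).
Hypotheses (PhiI : intertwines act Phi) (PsiI : intertwines act Psi).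
Hypotheses (cPhi : forall v, continuous (Phi v)) (cPsi : forall w, continuous (Psi w)).

(** The map Psi^* Phi intertwines [pi] and [sigma]; a nonzero pairing makes it nonzero, and Schur's
    lemma then gives an equivalence. *)
Lemma intertwiners_orthogonal v w : ~ unitarily_equivalent pi sigma ->
  L2inner mu (Phi v) (Psi w) = 0.
Proof.
move=> neq; have [[PhiL PhiE] [PsiL PsiE]] := (PhiI, PsiI).
have ipC := L2inner_product homK inv; have Csub := @continuous_subspace R K.
have /choice[A AE] u : exists t, forall z, L2inner mu (Psi z) (Phi u) = inner z t.
  have [|t _ tE] := riesz_finite_dim sW ipW Wfin
      (phi := fun z => L2inner mu (Psi z) (Phi u)).
    move=> a x y _ _ /=; rewrite PsiL.
    exact: (ip_linear ipC a (@cPsi x) (@cPsi y) (@cPhi u)).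
  by exists t => z; exact: tE.
have Aeq (t t' : rep_space sigma) : (forall z, inner z t = inner z t') -> t = t'.
  move=> tt'; apply: (ip_inj sW ipW) => // z _.
  by rewrite inner_conj tt' -inner_conj.
apply: contrapT => /eqP vw0; apply: neq; apply: (schur_equivalent (A := A)).
- move=> a x y; apply: Aeq => z; rewrite -AE PhiL.
  rewrite (ip_conj ipC (@cPsi z)); last first.
    exact: (continuousDC (@continuousZC _ _ a _ (@cPhi x)) (@cPhi y)).
  rewrite (ip_linear ipC a (@cPhi x) (@cPhi y) (@cPsi z)) inner_conj inner_linear.
  congr (_^*%C); congr (a * _ + _).
    by rewrite (ip_conj ipC (@cPhi x) (@cPsi z)) AE -inner_conj.
  by rewrite (ip_conj ipC (@cPhi y) (@cPsi z)) AE -inner_conj.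
- move=> g x; apply: Aeq => z; rewrite -AE PhiE.
  have cgx := @left_translate_continuous _ _ _ _ homK g _ (@cPhi x).
  rewrite (ip_conj ipC (@cPsi z) cgx).
  rewrite (L2inner_translateV homK inv g (@cPhi x) (@cPsi z)).
  rewrite -PsiE (ip_conj ipC (@cPhi x) (@cPsi _)) AE conjcK rep_innerV.
  by rewrite invgK.
- exists v; apply: contra_neq vw0 => Av0.
  by rewrite (ip_conj ipC (@cPhi v) (@cPsi w)) AE Av0 (ip0r sW ipW)// conjc0.
Qed.
End Orthogonality.
End Schur.

(** * Complete reducibility and the decomposition of an accessible space *)

Section IsotypicDecomposition.
Context {R : realType} {G : topGroupType} {K : ptopologicalType}.
Variables (act : G -> K -> K) (mu : probability (borel K) R).
Hypotheses (cG : compact [set: G]) (homK : homogeneous_space act).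
Hypothesis inv : invariant_measure act mu.
Variables (I : Type) (Ghat : I -> unitary_rep R G).
Hypothesis dualG : is_unitary_dual Ghat.
Variable S : set (K -> R[i]).
Hypotheses (Sfin : finite_dim_subspace S) (Scont : forall f, S f -> continuous f).
Hypothesis Sinv : G_invariant act S.

Let Ssub : subspace_set S := finite_dim_is_subspace Sfin.
Let ipC := L2inner_product homK inv.
Let ipS := L2inner_product_on homK inv Scont.

Definition embeds i (U : rep_space (Ghat i) -> K -> R[i]) (Y : set (K -> R[i])) :=
  [/\ intertwines act U, injective U & forall v, Y (U v)].

Lemma embeds_finite_dim i (U : rep_space (Ghat i) -> K -> R[i]) :
  embeds U S -> finite_dim_subspace [set: rep_space (Ghat i)].
Proof. by move=> [[UL _] Uinj US]; exact: finite_dim_inj Sfin UL Uinj US. Qed.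

Lemma subspace_left_translate (X : set (K -> R[i])) g :
  subspace_set X -> subspace_set [set f | X (left_translate act g f)].
Proof. by move=> [X0 XL]; split=> // a u v Xu Xv; exact: XL. Qed.

(** A minimal nonzero invariant subspace of [Y] is irreducible; its representative in the dual
    embeds through the inverse of the equivalence. *)
Lemma nonzero_embeds (Y : set (K -> R[i])) :
  Y `<=` S -> subspace_set Y -> G_invariant act Y -> (exists2 y, Y y & y != 0) ->
  exists i (U : rep_space (Ghat i) -> K -> R[i]), embeds U Y.
Proof.
move=> YS Ysub Yinv Y0; have Yfin := finite_dim_sub Sfin Ysub YS.
pose P (X : set (K -> R[i])) :=
  [/\ subspace_set X, G_invariant act X & exists2 y, X y & y != 0].
have [|//|X [XY [Xsub Xinv [y Xy y0]] Xmin]] := @minimal_subspace _ _ P Y Yfin.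
  by move=> X [].
have XS := subset_trans XY YS.
have Xfin := finite_dim_sub Sfin Xsub XS.
have [pi [U [[UL UE] UI XU Usurj]]] :=
  subrepresentation homK inv Xfin (fun f Xf => Scont (XS _ Xf)) Xinv.
have ipV := inner_inner_product (rep_space pi).
have sV := @setT_subspace _ (rep_space pi).
have Uinj : injective U.
  move=> v w vw; apply: (ip_inj sV ipV) => // z _.
  by rewrite -!UI vw.
have irr_pi : irreducible pi.
  split.
    have [v vy] := Usurj _ Xy; exists v; apply: contra_neq y0 => v0.
    by rewrite -vy v0 (linear_map0 UL).
  move=> V _ Vsub Vinv.
  have [V0|/existsNP[v /not_implyP[Vv v0]]] := pselect (forall v, V v -> v = 0).
    by left; apply/seteqP; split=> [v /V0|_ ->] //; exact: Vsub.1.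
  right; have UVX : U @` V = X.
    apply: Xmin; last by move=> _ [w _ <-].
    split; first exact: image_subspace.
      by move=> g _ [w Vw <-]; exists (pi g w); [exact: Vinv|exact: UE].
    exists (U v); first by exists v.
    by apply/eqP => Uv; apply: v0; apply: Uinj; rewrite Uv (linear_map0 UL).
  apply/seteqP; split=> // w _; have : X (U w) by exact: XU.
  by rewrite -UVX => -[w' Vw' /Uinj <-].
have [_ _ dual] := dualG; have [i [T [TL TI Tsurj TE]]] := dual _ irr_pi.
have /choice[T' T'K] := Tsurj.
have Tinj : injective T.
  by move=> v w vw; apply: (ip_inj sV ipV) => // z _; rewrite -!TI vw.
exists i, (fun w => U (T' w)); split.
- split=> [a v w|g v].
    by rewrite -UL; congr U; apply: Tinj; rewrite TL !T'K.
  by rewrite -UE; congr U; apply: Tinj; rewrite TE !T'K.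
- by move=> v w /Uinj vw; rewrite -[v]T'K vw T'K.
- by move=> v; exact/XY/XU.
Qed.

(** The sum of all irreducible subspaces of S; its equality with S is complete reducibility. *)
Definition embedded_span : set (K -> R[i]) :=
  linear_span [set f | exists i (U : rep_space (Ghat i) -> K -> R[i]) v,
    embeds U S /\ f = U v].

Lemma embedded_span_sub : embedded_span `<=` S.
Proof.
by apply: (linear_span_min Ssub) => _ [i [U [v [[_ _ US] ->]]]]; exact: US.
Qed.

Lemma embedded_span_invariant : G_invariant act embedded_span.
Proof.
move=> g f; have Esub := linear_span_subspace
  [set f | exists i (U : rep_space (Ghat i) -> K -> R[i]) v, embeds U S /\ f = U v].
apply: (linear_span_min (subspace_left_translate g Esub)).
move=> _ [i [U [v [eU ->]]]]; apply: sub_linear_span.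
by exists i, U, (Ghat i g v); split=> //; case: eU => -[_ ->].
Qed.

(* Otherwise the orthogonal complement of the span in [S] would contain a
   further embedded irreducible representation. *)
Lemma embedded_spanE : embedded_span = S.
Proof.
apply/seteqP; split=> [|s Ss]; first exact: embedded_span_sub.
have Esub : subspace_set embedded_span by exact: linear_span_subspace.
have Efin := finite_dim_sub Sfin Esub embedded_span_sub.
have Econt f : embedded_span f -> continuous f.
  by move=> Ef; exact/Scont/embedded_span_sub.
have [t Et tE] := orthogonal_projection_exists homK inv Efin Econt (Scont Ss).
have St := embedded_span_sub Et.
have [st|st] := eqVneq (s - t) 0.
  by move/eqP: st; rewrite subr_eq0 => /eqP ->.
pose Y := [set y | S y /\ forall x, embedded_span x -> L2inner mu y x = 0].
have [|||//|i [U [UI Uinj UY]]] := @nonzero_embeds Y.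
- by move=> y [].
- split.
    split=> [|x Ex]; first exact: Ssub.1.
    exact: (ip0l Ssub ipS (embedded_span_sub Ex)).
  move=> a y z [Sy Yy] [Sz Yz]; split=> [|x Ex]; first exact: Ssub.2.
  rewrite (ip_linear ipS a Sy Sz (embedded_span_sub Ex)).
  by rewrite Yy// Yz// mulr0 addr0.
- move=> g y [Sy Yy]; split=> [|x Ex]; first exact: Sinv.
  rewrite (L2inner_translateV homK inv g (Scont Sy) (Econt _ Ex)).
  by apply: Yy; exact: embedded_span_invariant.
- by exists (s - t) => //; split; [exact: subspace_setB|exact: tE].
have eU : embeds U S by split=> // v; case: (UY v).
have U0 v : U v = 0.
  have [SUv YUv] := UY v; apply: (ip_eq0 ipS SUv); apply: YUv.
  by apply: sub_linear_span; exists i, U, v.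
have [/(_ i) [[v v0] _] _ _] := dualG.
by case/eqP: v0; apply: Uinj; rewrite !U0.
Qed.

Variable x0 : K.
Let iso i := isotypic_component act x0 (Ghat i).

(** Finiteness is tracked element by element, so that a finite spanning family of S yields a finite
    set of classes. The embeddings are recorded as input for [accessible_intertwines]. *)
Lemma embedded_finite_support f : S f -> exists L : set I,
  [/\ finite_set L,
      forall i, L i -> exists U : rep_space (Ghat i) -> K -> R[i], embeds U S &
      linear_span (\bigcup_(i in L) iso i) f].
Proof.
rewrite -{1}embedded_spanE.
pose W := [set f | exists L : set I, [/\ finite_set L,
  forall i, L i -> exists U : rep_space (Ghat i) -> K -> R[i], embeds U S &
  linear_span (\bigcup_(i in L) iso i) f]].
apply: (linear_span_min (W := W)).
  split=> [|a u v [L [Lfin LU Lu]] [L' [L'fin L'U L'v]]].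
    by exists set0; split=> //; exact: (linear_span_subspace _).1.
  exists (L `|` L'); split; first by rewrite finite_setU.
    by move=> i [/LU|/L'U].
  apply: (linear_span_subspace _).2.
    by apply: linear_span_mono Lu; apply: bigcup_subset => i Li; left.
  by apply: linear_span_mono L'v; apply: bigcup_subset => i Li; right.
move=> _ [i [U [v [eU ->]]]]; exists [set i]; split.
- exact: finite_set1.
- by move=> _ ->; exists U.
- apply: sub_linear_span; exists i => //.
  by apply: intertwines_isotypic; [exact: embeds_finite_dim eU|case: eU].
Qed.

Lemma linear_span_orthogonal (A B : set (K -> R[i])) f h :
  (forall a, A a -> continuous a) -> (forall b, B b -> continuous b) ->
  (forall a b, A a -> B b -> L2inner mu a b = 0) ->
  linear_span A f -> linear_span B h -> L2inner mu f h = 0.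
Proof.
move=> cA cB AB Af Bh; have Csub := @continuous_subspace R K.
have orth_sub k : continuous k ->
    subspace_set [set a : K -> R[i] | continuous a /\ L2inner mu a k = 0].
  move=> ck; split=> [|a u v [cu uk] [cv vk]].
    by split; [exact: Csub.1|exact: (ip0l Csub ipC ck)].
  split; first exact: (Csub.2 a u v cu cv).
  by rewrite (ip_linear ipC a cu cv ck) uk vk mulr0 addr0.
have Ab b : B b -> continuous f /\ L2inner mu f b = 0.
  move=> Bb; apply: (linear_span_min (orth_sub b (cB b Bb)) _ Af) => a Aa.
  by split; [exact: cA|exact: AB].
have cf : continuous f by exact: (linear_span_min Csub cA Af).
have [ch hf] : continuous h /\ L2inner mu h f = 0.
  apply: (linear_span_min (orth_sub f cf) _ Bh) => b Bb; have cb := cB b Bb; split=> //.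
  by rewrite (ip_conj ipC cb cf) (Ab b Bb).2 conjc0.
by rewrite (ip_conj ipC cf ch) hf conjc0.
Qed.

Lemma accessible_isotypic_sum : G_accessible act mu S -> exists Lambda : set I,
  finite_set Lambda /\ is_orthogonal_sum_of_isotypic act mu x0 Ghat Lambda S.
Proof.
move=> accS; have [irrG eqG _] := dualG; have [n [b Sb]] := Sfin.
have bS k : S (b k) by rewrite Sb; apply: sub_linear_span; exact: imageT.
have /choice[L LP] k := embedded_finite_support (bS k).
pose Lambda := \bigcup_(k in [set: 'I_n]) L k.
have LambdaU i : Lambda i -> exists U : rep_space (Ghat i) -> K -> R[i], embeds U S.
  by move=> [k _ Li]; have [_ LU _] := LP k; exact: LU.
have Lambdafin i : Lambda i -> finite_dim_subspace [set: rep_space (Ghat i)].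
  by move=> /LambdaU[U eU]; exact: embeds_finite_dim eU.
exists Lambda; split.
  by apply: bigcup_finite => [|k _]; [exact: finite_finset|case: (LP k)].
split.
  move=> i j Li Lj ij f h fi hj.
  have coef_orth u u' v v' : fixed_vectors act x0 u -> fixed_vectors act x0 u' ->
      L2inner mu (matrix_coef (pi := Ghat i) act x0 u v)
                 (matrix_coef (pi := Ghat j) act x0 u' v') = 0.
    move=> fu fu'; apply: (intertwiners_orthogonal (irrG i) (irrG j)
      (Lambdafin i Li) homK inv (Lambdafin j Lj)).
    - exact: matrix_coef_intertwines.
    - exact: matrix_coef_intertwines.
    - by move=> w; exact: matrix_coef_continuous.
    - by move=> w; exact: matrix_coef_continuous.
    - by move=> /eqG.
  apply: (linear_span_orthogonal _ _ _ fi hj).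
  - by move=> a ga; apply: (isotypic_continuous cG homK); exact: sub_linear_span ga.
  - by move=> a ga; apply: (isotypic_continuous cG homK); exact: sub_linear_span ga.
  - move=> a b' [u [v [fu /(eq_matrix_coef homK fu) ->]]].
    by move=> [u' [v' [fu' /(eq_matrix_coef homK fu') ->]]]; exact: coef_orth.
apply/seteqP; split.
  rewrite {1}Sb; apply: linear_span_min; first exact: linear_span_subspace.
  move=> _ [k _ <-]; have [_ _] := LP k; apply: linear_span_mono.
  by apply: bigcup_subset => i Li; exists k.
apply: (linear_span_min Ssub) => f [i Li].
apply: (linear_span_min Ssub) => {}f [u [v [fu /(eq_matrix_coef homK fu) ->]]].
have [U [UI Uinj US]] := LambdaU i Li.
(* Accessibility enters here: the embedding [U] forces every coefficient map of the same
   representation into S. *)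
apply: (accessible_intertwines homK inv Sfin Scont Sinv v accS
  (Lambdafin i Li) UI Uinj US); first exact: matrix_coef_intertwines.
by move=> w; exact: matrix_coef_continuous.
Qed.

End IsotypicDecomposition.

Theorem theorem1p9 (R : realType) (G : topGroupType) (K : ptopologicalType)
    (act : G -> K -> K) (mu : probability (borel K) R)
    (I : Type) (Ghat : I -> unitary_rep R G) (x0 : K) (S : set (K -> R[i])) :
  compact [set: G] -> hausdorff_space G ->
  homogeneous_space act ->
  regular_measure mu -> invariant_measure act mu ->
  is_unitary_dual Ghat ->
  finite_dim_subspace S -> (forall f, S f -> continuous f) -> G_invariant act S ->
  G_accessible act mu S <->
  exists Lambda : set I,
    finite_set Lambda /\ is_orthogonal_sum_of_isotypic act mu x0 Ghat Lambda S.
Proof.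
move=> cG _ homK _ inv dualG Sfin Scont Sinv; split.
  exact: (accessible_isotypic_sum cG homK inv dualG Sfin Scont Sinv).
have [irr _ _] := dualG => -[Lambda [_ [_ SE]]].
exact: (isotypic_sum_accessible cG homK inv Sfin Scont irr SE).
Qed.
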